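(* Let $a,b,c,d\in\mathbb{N}$ and let $\mathfrak{g}=\mathfrak{g}(A)$ be the Borcherds--Kac--Moody Lie algebra of $A=A(b,a,c,d)=\begin{bmatrix}-b&-a\\-c&-d\end{bmatrix}$. Let $\lambda\in P^{\pm}$, with associated powers $M_1,M_2\in\mathbb{N}$ determined by $\lambda(\alpha_i^{\vee})=\frac{A_{ii}}{2}(M_i-1)$ for $i=1,2$. Let $\mu=\lambda-X\alpha_1-Y\alpha_2$, where $(X,Y)$ satisfies $$bX^2+\frac{ad}{c}Y^2-bM_1X-\frac{ad}{c}M_2Y+2aXY=0 .$$ (A1) Suppose $(X,Y)=(2,n)$ or $(X,Y)=(n,2)$ with $n\in\mathbb{N}$. Then the number of linearly independent maximal vectors in the weight space $M(\lambda)_{\mu}$ (the dimension of the space of vectors of $M(\lambda)_\mu$ killed by $\mathfrak{n}^+$) equals $$\dim\mathrm{Hom}_{\mathfrak{g}}\big(M(\mu),M(\lambda)\big)=\Big\lceil\frac{n+1}{2}\Big\rceil ,$$ and this number equals $\dim\mathfrak{g}_{2\alpha_1+n\alpha_2}+\dim\mathfrak{g}_{\alpha_1+\frac n2\alpha_2}$ when $(X,Y)=(2,n)$, respectively $\dim\mathfrak{g}_{n\alpha_1+2\alpha_2}+\dim\mathfrak{g}_{\frac n2\alpha_1+\alpha_2}$ when $(X,Y)=(n,2)$. (A2) Suppose $(X,Y)=(3,3)$. Then $M(\lambda)_{\mu}$ has exactly $\dim\mathfrak{g}_{\alpha_1+\alpha_2}+\dim\mathfrak{g}_{3\alpha_1+3\alpha_2}=4$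 linearly independent maximal vectors.
   Context: All Lie algebras and modules are over $\mathbb{C}$; $\mathbb{N}=\{1,2,\dots\}$. For $A=(A_{ij})_{i,j\in\{1,2\}}=A(b,a,c,d)$ with $a,b,c,d\in\mathbb{N}$ (so $A_{11}=-b$, $A_{12}=-a$, $A_{21}=-c$, $A_{22}=-d$), fix a realization: a vector space $\mathfrak{h}$ of dimension $4-\mathrm{rank}(A)$, linearly independent simple roots $\alpha_1,\alpha_2\in\mathfrak{h}^*$ and linearly independent simple co-roots $\alpha_1^\vee,\alpha_2^\vee\in\mathfrak{h}$ with $\alpha_j(\alpha_i^\vee)=A_{ij}$. The Borcherds--Kac--Moody Lie algebra $\mathfrak{g}(A)$ is generated by $\mathfrak{h}$ and $e_1,e_2,f_1,f_2$ with relations $[h,h']=0$, $[h,e_i]=\alpha_i(h)e_i$, $[h,f_i]=-\alpha_i(h)f_i$, $[e_i,f_j]=\delta_{ij}\alpha_i^\vee$ for $h,h'\in\mathfrak{h}$ (no Serre relations are needed, since all $A_{ij}<0$). It has the triangular decomposition $\mathfrak{g}=\mathfrak{n}^+\oplus\mathfrak{h}\oplus\mathfrak{n}^-$, with $\mathfrak{n}^+$ (resp. $\mathfrak{n}^-$) generated by $e_1,e_2$ (resp. $f_1,f_2$). For $\beta\in\mathfrak{h}^*$, $\mathfrak{g}_\beta$ is the $\beta$-eigenspace of $\mathfrak{h}$ acting on $\mathfrak{g}$ by the adjoint action (so $\mathfrak{g}_\beta=0$ if $\beta\neq 0$ is not a root, e.g. if a coefficient of $\beta$ in terms of $\alpha_1,\alpha_2$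 is not an integer). The signed-dominant-integral cone is $P^{\pm}=\{\lambda\in\mathfrak{h}^*\mid \lambda(\alpha_i^\vee)\in\frac{A_{ii}}{2}\mathbb{Z}_{\geq0}\text{ for } i=1,2\}$. For $\lambda\in\mathfrak{h}^*$, $M(\lambda)$ is the Verma module with highest weight $\lambda$, and $M(\lambda)_\mu$ is its $\mu$-weight space. A maximal vector is a nonzero weight vector killed by $\mathfrak{n}^+$ (equivalently by $e_1$ and $e_2$). *)

(* Defs.v *)
From HB Require Import structures.
From mathcomp Require Import all_boot all_order all_algebra generic_quotient.
From mathcomp Require Import boolp classical_sets functions reals complex.

Set Implicit Arguments.
Unset Strict Implicit.
Unset Printing Implicit Defensive.

Import GRing.Theory.
Local Open Scope quotient_scope.
Local Open Scope ring_scope.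

HB.mixin Record isLieAlgebra (K : fieldType) L of GRing.Lmodule K L := {
  bracket : L -> L -> L;
  bracketDl : forall x y z, bracket (x + y) z = bracket x z + bracket y z;
  bracketDr : forall x y z, bracket x (y + z) = bracket x y + bracket x z;
  bracketZl : forall (k : K) x y, bracket (k *: x) y = k *: bracket x y;
  bracketZr : forall (k : K) x y, bracket x (k *: y) = k *: bracket x y;
  bracketxx : forall x, bracket x x = 0;
  jacobi : forall x y z,
    bracket x (bracket y z) + bracket y (bracket z x)
      + bracket z (bracket x y) = 0
}.

#[short(type="lieAlgType")]
HB.structure Definition LieAlgebra (K : fieldType) :=
  { L of GRing.Lmodule K L & isLieAlgebra K L }.

HB.mixin Record isLieModule (K : fieldType) (L : lieAlgType K) M
    of GRing.Lmodule K M := {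
  act : L -> M -> M;
  actDl : forall x y m, act (x + y) m = act x m + act y m;
  actDr : forall x m n, act x (m + n) = act x m + act x n;
  actZl : forall (k : K) x m, act (k *: x) m = k *: act x m;
  actZr : forall (k : K) x m, act x (k *: m) = k *: act x m;
  act_bracket : forall x y m,
    act (bracket x y) m = act x (act y m) - act y (act x m)
}.

#[short(type="lieModType")]
HB.structure Definition LieModule (K : fieldType) (L : lieAlgType K) :=
  { M of GRing.Lmodule K M & isLieModule K L M }.

Definition lie_hom (K : fieldType) (L L' : lieAlgType K) (f : L -> L') : Prop :=
  linear f /\ forall x y, f (bracket x y) = bracket (f x) (f y).

Definition module_hom (K : fieldType) (L : lieAlgType K)
    (M N : lieModType L) (f : M -> N) : Prop :=
  linear f /\ forall x m, f (act x m) = act x (f m).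

Inductive generated_subalgebra (K : fieldType) (L : lieAlgType K)
    (S : set L) : set L :=
| gs_gen x : S x -> generated_subalgebra S x
| gs_zero : generated_subalgebra S 0
| gs_add x y : generated_subalgebra S x -> generated_subalgebra S y ->
    generated_subalgebra S (x + y)
| gs_scale (k : K) x : generated_subalgebra S x -> generated_subalgebra S (k *: x)
| gs_bracket x y : generated_subalgebra S x -> generated_subalgebra S y ->
    generated_subalgebra S (bracket x y).

(** [has_dim S n]: [S] is a subspace of dimension [n].  The ambient space may be
    infinite-dimensional, hence not a [vectType]. *)
Definition has_dim (K : fieldType) (V : lmodType K) (S : set V) (n : nat) : Prop :=
  exists b : 'I_n -> V,
    (forall k : 'I_n -> K, \sum_i k i *: b i = 0 -> forall i, k i = 0) /\
    (forall v, S v <-> exists k : 'I_n -> K, v = \sum_i k i *: b i).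

Section LiePresentation.
Variables (K : fieldType) (X : Type).

Inductive lie_term :=
| Lgen of X
| Lzero
| Ladd of lie_term & lie_term
| Lscale of K & lie_term
| Lbracket of lie_term & lie_term.

HB.instance Definition _ := gen_eqMixin lie_term.
HB.instance Definition _ := gen_choiceMixin lie_term.

Variable rel : lie_term -> lie_term -> Prop.

Inductive lie_eq : lie_term -> lie_term -> Prop :=
| Leq_rel s t : rel s t -> lie_eq s t
| Leq_refl t : lie_eq t t
| Leq_sym s t : lie_eq s t -> lie_eq t s
| Leq_trans s t u : lie_eq s t -> lie_eq t u -> lie_eq s u
| Leq_add s s' t t' :
    lie_eq s s' -> lie_eq t t' -> lie_eq (Ladd s t) (Ladd s' t')
| Leq_scale k s s' : lie_eq s s' -> lie_eq (Lscale k s) (Lscale k s')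
| Leq_bracket s s' t t' :
    lie_eq s s' -> lie_eq t t' -> lie_eq (Lbracket s t) (Lbracket s' t')
| Leq_addA s t u : lie_eq (Ladd s (Ladd t u)) (Ladd (Ladd s t) u)
| Leq_addC s t : lie_eq (Ladd s t) (Ladd t s)
| Leq_add0 s : lie_eq (Ladd Lzero s) s
| Leq_addN s : lie_eq (Ladd (Lscale (-1) s) s) Lzero
| Leq_scaleA k l s : lie_eq (Lscale k (Lscale l s)) (Lscale (k * l) s)
| Leq_scale1 s : lie_eq (Lscale 1 s) s
| Leq_scaleDr k s t :
    lie_eq (Lscale k (Ladd s t)) (Ladd (Lscale k s) (Lscale k t))
| Leq_scaleDl k l s :
    lie_eq (Lscale (k + l) s) (Ladd (Lscale k s) (Lscale l s))
| Leq_bracketDl s t u :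
    lie_eq (Lbracket (Ladd s t) u) (Ladd (Lbracket s u) (Lbracket t u))
| Leq_bracketDr s t u :
    lie_eq (Lbracket s (Ladd t u)) (Ladd (Lbracket s t) (Lbracket s u))
| Leq_bracketZl k s t :
    lie_eq (Lbracket (Lscale k s) t) (Lscale k (Lbracket s t))
| Leq_bracketZr k s t :
    lie_eq (Lbracket s (Lscale k t)) (Lscale k (Lbracket s t))
| Leq_bracketxx s : lie_eq (Lbracket s s) Lzero
| Leq_jacobi s t u :
    lie_eq (Ladd (Ladd (Lbracket s (Lbracket t u)) (Lbracket t (Lbracket u s)))
                 (Lbracket u (Lbracket s t)))
           Lzero.

Definition lie_eqb (s t : lie_term) : bool := `[< lie_eq s t >].

Lemma lie_eqb_refl : reflexive lie_eqb.
Proof. by move=> t; apply/asboolP; apply: Leq_refl. Qed.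

Lemma lie_eqb_sym : symmetric lie_eqb.
Proof. by move=> s t; apply/asboolP/asboolP; apply: Leq_sym. Qed.

Lemma lie_eqb_trans : transitive lie_eqb.
Proof.
by move=> t s u /asboolP st /asboolP tu; apply/asboolP; apply: Leq_trans st tu.
Qed.

Canonical lie_equiv := EquivRel lie_eqb lie_eqb_refl lie_eqb_sym lie_eqb_trans.

Definition presented_lie := {eq_quot lie_equiv}.

HB.instance Definition _ := Choice.on presented_lie.
HB.instance Definition _ := EqQuotient.on presented_lie.

Definition lie_class (t : lie_term) : presented_lie := \pi_presented_lie t.

Lemma lie_classP s t : lie_class s = lie_class t <-> lie_eq s t.
Proof. by split=> [/eqmodP/asboolP|st] //; apply/eqmodP/asboolP. Qed.

Lemma lie_class_repr (x : presented_lie) : lie_class (repr x) = x.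
Proof. exact: reprK. Qed.

Lemma lie_repr_class t : lie_eq (repr (lie_class t)) t.
Proof. by apply/lie_classP; rewrite lie_class_repr. Qed.

Lemma lie_class_ind (P : presented_lie -> Prop) :
  (forall t, P (lie_class t)) -> forall x, P x.
Proof. by move=> Pt x; rewrite -[x]lie_class_repr. Qed.

Definition plie_add (x y : presented_lie) := lie_class (Ladd (repr x) (repr y)).
Definition plie_opp (x : presented_lie) := lie_class (Lscale (-1) (repr x)).
Definition plie_scale (k : K) (x : presented_lie) := lie_class (Lscale k (repr x)).
Definition plie_bracket (x y : presented_lie) :=
  lie_class (Lbracket (repr x) (repr y)).

Lemma plie_addE s t : plie_add (lie_class s) (lie_class t) = lie_class (Ladd s t).
Proof. by apply/lie_classP; apply: Leq_add; apply: lie_repr_class. Qed.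

Lemma plie_oppE s : plie_opp (lie_class s) = lie_class (Lscale (-1) s).
Proof. by apply/lie_classP; apply: Leq_scale; apply: lie_repr_class. Qed.

Lemma plie_scaleE k s : plie_scale k (lie_class s) = lie_class (Lscale k s).
Proof. by apply/lie_classP; apply: Leq_scale; apply: lie_repr_class. Qed.

Lemma plie_bracketE s t :
  plie_bracket (lie_class s) (lie_class t) = lie_class (Lbracket s t).
Proof. by apply/lie_classP; apply: Leq_bracket; apply: lie_repr_class. Qed.

Lemma plie_addA : associative plie_add.
Proof.
elim/lie_class_ind=> s; elim/lie_class_ind=> t; elim/lie_class_ind=> u.
by rewrite !plie_addE; apply/lie_classP; constructor.
Qed.

Lemma plie_addC : commutative plie_add.
Proof.
elim/lie_class_ind=> s; elim/lie_class_ind=> t.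
by rewrite !plie_addE; apply/lie_classP; constructor.
Qed.

Lemma plie_add0 : left_id (lie_class Lzero) plie_add.
Proof. by elim/lie_class_ind=> s; rewrite plie_addE; apply/lie_classP; constructor. Qed.

Lemma plie_addN : left_inverse (lie_class Lzero) plie_opp plie_add.
Proof.
elim/lie_class_ind=> s; rewrite plie_oppE plie_addE.
by apply/lie_classP; constructor.
Qed.

HB.instance Definition _ :=
  GRing.isZmodule.Build presented_lie plie_addA plie_addC plie_add0 plie_addN.

Lemma plie_scaleA k l x : plie_scale k (plie_scale l x) = plie_scale (k * l) x.
Proof.
elim/lie_class_ind: x => s; rewrite !plie_scaleE.
by apply/lie_classP; constructor.
Qed.

Lemma plie_scale1 : left_id 1 plie_scale.
Proof. by elim/lie_class_ind=> s; rewrite plie_scaleE; apply/lie_classP; constructor. Qed.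

Lemma plie_scaleDr : right_distributive plie_scale +%R.
Proof.
move=> k; elim/lie_class_ind=> s; elim/lie_class_ind=> t.
rewrite /GRing.add /= plie_addE !plie_scaleE plie_addE.
by apply/lie_classP; constructor.
Qed.

Lemma plie_scaleDl x : {morph plie_scale^~ x : k l / k + l}.
Proof.
move=> k l; elim/lie_class_ind: x => s.
rewrite [RHS]/GRing.add /= !plie_scaleE plie_addE.
by apply/lie_classP; constructor.
Qed.

HB.instance Definition _ :=
  GRing.Zmodule_isLmodule.Build K presented_lie
    plie_scaleA plie_scale1 plie_scaleDr plie_scaleDl.

Lemma lie_class0 : lie_class Lzero = 0.
Proof. by []. Qed.

Lemma lie_classD s t : lie_class (Ladd s t) = lie_class s + lie_class t.
Proof. by rewrite -plie_addE. Qed.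

Lemma lie_classZ k s : lie_class (Lscale k s) = k *: lie_class s.
Proof. by rewrite -plie_scaleE. Qed.

Lemma plie_bracketDl x y z :
  plie_bracket (x + y) z = plie_bracket x z + plie_bracket y z.
Proof.
elim/lie_class_ind: x => s; elim/lie_class_ind: y => t; elim/lie_class_ind: z => u.
rewrite -lie_classD !plie_bracketE -lie_classD.
by apply/lie_classP; constructor.
Qed.

Lemma plie_bracketDr x y z :
  plie_bracket x (y + z) = plie_bracket x y + plie_bracket x z.
Proof.
elim/lie_class_ind: x => s; elim/lie_class_ind: y => t; elim/lie_class_ind: z => u.
rewrite -lie_classD !plie_bracketE -lie_classD.
by apply/lie_classP; constructor.
Qed.

Lemma plie_bracketZl (k : K) x y : plie_bracket (k *: x) y = k *: plie_bracket x y.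
Proof.
elim/lie_class_ind: x => s; elim/lie_class_ind: y => t.
rewrite -lie_classZ !plie_bracketE -lie_classZ.
by apply/lie_classP; constructor.
Qed.

Lemma plie_bracketZr (k : K) x y : plie_bracket x (k *: y) = k *: plie_bracket x y.
Proof.
elim/lie_class_ind: x => s; elim/lie_class_ind: y => t.
rewrite -lie_classZ !plie_bracketE -lie_classZ.
by apply/lie_classP; constructor.
Qed.

Lemma plie_bracketxx x : plie_bracket x x = 0.
Proof.
elim/lie_class_ind: x => s; rewrite plie_bracketE -lie_class0.
by apply/lie_classP; constructor.
Qed.

Lemma plie_jacobi x y z :
  plie_bracket x (plie_bracket y z) + plie_bracket y (plie_bracket z x)
    + plie_bracket z (plie_bracket x y) = 0.
Proof.
elim/lie_class_ind: x => s; elim/lie_class_ind: y => t; elim/lie_class_ind: z => u.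
rewrite !plie_bracketE -!lie_classD -lie_class0.
by apply/lie_classP; constructor.
Qed.

HB.instance Definition _ :=
  isLieAlgebra.Build K presented_lie
    plie_bracketDl plie_bracketDr plie_bracketZl plie_bracketZr
    plie_bracketxx plie_jacobi.

Lemma lie_class_bracket s t :
  lie_class (Lbracket s t) = bracket (lie_class s) (lie_class t).
Proof. by rewrite -plie_bracketE. Qed.

Fixpoint lie_eval (L : lieAlgType K) (g : X -> L) (t : lie_term) : L :=
  match t with
  | Lgen x => g x
  | Lzero => 0
  | Ladd s t => lie_eval g s + lie_eval g t
  | Lscale k s => k *: lie_eval g s
  | Lbracket s t => bracket (lie_eval g s) (lie_eval g t)
  end.

Lemma presented_lie_universal (L : lieAlgType K) (g : X -> L) :
  (forall s t, rel s t -> lie_eval g s = lie_eval g t) ->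
  exists2 f : presented_lie -> L, lie_hom f &
    forall x, f (lie_class (Lgen x)) = g x.
Proof.
move=> grel.
have geq s t : lie_eq s t -> lie_eval g s = lie_eval g t.
  elim=> {s t} /=; do ?by move=> *; congruence.
  - exact: grel.
  - by move=> *; rewrite addrA.
  - by move=> *; rewrite addrC.
  - by move=> *; rewrite add0r.
  - by move=> *; rewrite scaleN1r addNr.
  - by move=> *; rewrite scalerA.
  - by move=> *; rewrite scale1r.
  - by move=> *; rewrite scalerDr.
  - by move=> *; rewrite scalerDl.
  - by move=> *; rewrite bracketDl.
  - by move=> *; rewrite bracketDr.
  - by move=> *; rewrite bracketZl.
  - by move=> *; rewrite bracketZr.
  - by move=> *; rewrite bracketxx.
  - by move=> *; rewrite jacobi.
pose f (x : presented_lie) := lie_eval g (repr x).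
have fE t : f (lie_class t) = lie_eval g t by apply: geq; apply: lie_repr_class.
exists f => [|x]; last exact: fE.
split=> [k|]; elim/lie_class_ind=> s; elim/lie_class_ind=> t.
  by rewrite -lie_classZ -lie_classD !fE.
by rewrite -lie_class_bracket !fE.
Qed.

End LiePresentation.

Arguments Lzero {K X}.
Arguments Lgen {K X} _.

Section ModulePresentation.
Variables (K : fieldType) (L : lieAlgType K) (X : Type).

Inductive mod_term :=
| Mgen of X
| Mzero
| Madd of mod_term & mod_term
| Mscale of K & mod_term
| Mact of L & mod_term.

HB.instance Definition _ := gen_eqMixin mod_term.
HB.instance Definition _ := gen_choiceMixin mod_term.

Variable rel : mod_term -> mod_term -> Prop.

Inductive mod_eq : mod_term -> mod_term -> Prop :=
| Meq_rel s t : rel s t -> mod_eq s t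
| Meq_refl t : mod_eq t t
| Meq_sym s t : mod_eq s t -> mod_eq t s
| Meq_trans s t u : mod_eq s t -> mod_eq t u -> mod_eq s u
| Meq_add s s' t t' :
    mod_eq s s' -> mod_eq t t' -> mod_eq (Madd s t) (Madd s' t')
| Meq_scale k s s' : mod_eq s s' -> mod_eq (Mscale k s) (Mscale k s')
| Meq_act x s s' : mod_eq s s' -> mod_eq (Mact x s) (Mact x s')
| Meq_addA s t u : mod_eq (Madd s (Madd t u)) (Madd (Madd s t) u)
| Meq_addC s t : mod_eq (Madd s t) (Madd t s)
| Meq_add0 s : mod_eq (Madd Mzero s) s
| Meq_addN s : mod_eq (Madd (Mscale (-1) s) s) Mzero
| Meq_scaleA k l s : mod_eq (Mscale k (Mscale l s)) (Mscale (k * l) s)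
| Meq_scale1 s : mod_eq (Mscale 1 s) s
| Meq_scaleDr k s t :
    mod_eq (Mscale k (Madd s t)) (Madd (Mscale k s) (Mscale k t))
| Meq_scaleDl k l s :
    mod_eq (Mscale (k + l) s) (Madd (Mscale k s) (Mscale l s))
| Meq_actDl x y s : mod_eq (Mact (x + y) s) (Madd (Mact x s) (Mact y s))
| Meq_actDr x s t : mod_eq (Mact x (Madd s t)) (Madd (Mact x s) (Mact x t))
| Meq_actZl k x s : mod_eq (Mact (k *: x) s) (Mscale k (Mact x s))
| Meq_actZr k x s : mod_eq (Mact x (Mscale k s)) (Mscale k (Mact x s))
| Meq_bracket x y s :
    mod_eq (Mact (bracket x y) s)
           (Madd (Mact x (Mact y s)) (Mscale (-1) (Mact y (Mact x s)))).

Definition mod_eqb (s t : mod_term) : bool := `[< mod_eq s t >].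

Lemma mod_eqb_refl : reflexive mod_eqb.
Proof. by move=> t; apply/asboolP; apply: Meq_refl. Qed.

Lemma mod_eqb_sym : symmetric mod_eqb.
Proof. by move=> s t; apply/asboolP/asboolP; apply: Meq_sym. Qed.

Lemma mod_eqb_trans : transitive mod_eqb.
Proof.
by move=> t s u /asboolP st /asboolP tu; apply/asboolP; apply: Meq_trans st tu.
Qed.

Canonical mod_equiv := EquivRel mod_eqb mod_eqb_refl mod_eqb_sym mod_eqb_trans.

Definition presented_module := {eq_quot mod_equiv}.

HB.instance Definition _ := Choice.on presented_module.
HB.instance Definition _ := EqQuotient.on presented_module.

Definition mod_class (t : mod_term) : presented_module := \pi_presented_module t.

Lemma mod_classP s t : mod_class s = mod_class t <-> mod_eq s t.
Proof. by split=> [/eqmodP/asboolP|st] //; apply/eqmodP/asboolP. Qed.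

Lemma mod_class_repr (m : presented_module) : mod_class (repr m) = m.
Proof. exact: reprK. Qed.

Lemma mod_repr_class t : mod_eq (repr (mod_class t)) t.
Proof. by apply/mod_classP; rewrite mod_class_repr. Qed.

Lemma mod_class_ind (P : presented_module -> Prop) :
  (forall t, P (mod_class t)) -> forall m, P m.
Proof. by move=> Pt m; rewrite -[m]mod_class_repr. Qed.

Definition pmod_add (m n : presented_module) := mod_class (Madd (repr m) (repr n)).
Definition pmod_opp (m : presented_module) := mod_class (Mscale (-1) (repr m)).
Definition pmod_scale (k : K) (m : presented_module) :=
  mod_class (Mscale k (repr m)).
Definition pmod_act (x : L) (m : presented_module) := mod_class (Mact x (repr m)).

Lemma pmod_addE s t : pmod_add (mod_class s) (mod_class t) = mod_class (Madd s t).
Proof. by apply/mod_classP; apply: Meq_add; apply: mod_repr_class. Qed.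

Lemma pmod_oppE s : pmod_opp (mod_class s) = mod_class (Mscale (-1) s).
Proof. by apply/mod_classP; apply: Meq_scale; apply: mod_repr_class. Qed.

Lemma pmod_scaleE k s : pmod_scale k (mod_class s) = mod_class (Mscale k s).
Proof. by apply/mod_classP; apply: Meq_scale; apply: mod_repr_class. Qed.

Lemma pmod_actE x s : pmod_act x (mod_class s) = mod_class (Mact x s).
Proof. by apply/mod_classP; apply: Meq_act; apply: mod_repr_class. Qed.

Lemma pmod_addA : associative pmod_add.
Proof.
elim/mod_class_ind=> s; elim/mod_class_ind=> t; elim/mod_class_ind=> u.
by rewrite !pmod_addE; apply/mod_classP; constructor.
Qed.

Lemma pmod_addC : commutative pmod_add.
Proof.
elim/mod_class_ind=> s; elim/mod_class_ind=> t.
by rewrite !pmod_addE; apply/mod_classP; constructor.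
Qed.

Lemma pmod_add0 : left_id (mod_class Mzero) pmod_add.
Proof. by elim/mod_class_ind=> s; rewrite pmod_addE; apply/mod_classP; constructor. Qed.

Lemma pmod_addN : left_inverse (mod_class Mzero) pmod_opp pmod_add.
Proof.
elim/mod_class_ind=> s; rewrite pmod_oppE pmod_addE.
by apply/mod_classP; constructor.
Qed.

HB.instance Definition _ :=
  GRing.isZmodule.Build presented_module pmod_addA pmod_addC pmod_add0 pmod_addN.

Lemma pmod_scaleA k l m : pmod_scale k (pmod_scale l m) = pmod_scale (k * l) m.
Proof.
elim/mod_class_ind: m => s; rewrite !pmod_scaleE.
by apply/mod_classP; constructor.
Qed.

Lemma pmod_scale1 : left_id 1 pmod_scale.
Proof. by elim/mod_class_ind=> s; rewrite pmod_scaleE; apply/mod_classP; constructor. Qed.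

Lemma pmod_scaleDr : right_distributive pmod_scale +%R.
Proof.
move=> k; elim/mod_class_ind=> s; elim/mod_class_ind=> t.
rewrite /GRing.add /= pmod_addE !pmod_scaleE pmod_addE.
by apply/mod_classP; constructor.
Qed.

Lemma pmod_scaleDl m : {morph pmod_scale^~ m : k l / k + l}.
Proof.
move=> k l; elim/mod_class_ind: m => s.
rewrite [RHS]/GRing.add /= !pmod_scaleE pmod_addE.
by apply/mod_classP; constructor.
Qed.

HB.instance Definition _ :=
  GRing.Zmodule_isLmodule.Build K presented_module
    pmod_scaleA pmod_scale1 pmod_scaleDr pmod_scaleDl.

Lemma mod_class0 : mod_class Mzero = 0.
Proof. by []. Qed.

Lemma mod_classD s t : mod_class (Madd s t) = mod_class s + mod_class t.
Proof. by rewrite -pmod_addE. Qed.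

Lemma mod_classZ k s : mod_class (Mscale k s) = k *: mod_class s.
Proof. by rewrite -pmod_scaleE. Qed.

Lemma pmod_actDl x y m : pmod_act (x + y) m = pmod_act x m + pmod_act y m.
Proof.
elim/mod_class_ind: m => s; rewrite !pmod_actE -mod_classD.
by apply/mod_classP; constructor.
Qed.

Lemma pmod_actDr x m n : pmod_act x (m + n) = pmod_act x m + pmod_act x n.
Proof.
elim/mod_class_ind: m => s; elim/mod_class_ind: n => t.
rewrite -mod_classD !pmod_actE -mod_classD.
by apply/mod_classP; constructor.
Qed.

Lemma pmod_actZl (k : K) x m : pmod_act (k *: x) m = k *: pmod_act x m.
Proof.
elim/mod_class_ind: m => s; rewrite !pmod_actE -mod_classZ.
by apply/mod_classP; constructor.
Qed.

Lemma pmod_actZr (k : K) x m : pmod_act x (k *: m) = k *: pmod_act x m.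
Proof.
elim/mod_class_ind: m => s; rewrite -mod_classZ !pmod_actE -mod_classZ.
by apply/mod_classP; constructor.
Qed.

Lemma pmod_act_bracket x y m :
  pmod_act (bracket x y) m = pmod_act x (pmod_act y m) - pmod_act y (pmod_act x m).
Proof.
elim/mod_class_ind: m => s.
rewrite -scaleN1r !pmod_actE -mod_classZ -mod_classD.
by apply/mod_classP; constructor.
Qed.

HB.instance Definition _ :=
  isLieModule.Build K L presented_module
    pmod_actDl pmod_actDr pmod_actZl pmod_actZr pmod_act_bracket.

Lemma mod_class_act x s : mod_class (Mact x s) = act x (mod_class s).
Proof. by rewrite -pmod_actE. Qed.

Fixpoint mod_eval (M : lieModType L) (g : X -> M) (t : mod_term) : M :=
  match t with
  | Mgen x => g x
  | Mzero => 0
  | Madd s t => mod_eval g s + mod_eval g t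
  | Mscale k s => k *: mod_eval g s
  | Mact x s => act x (mod_eval g s)
  end.

Lemma presented_module_universal (M : lieModType L) (g : X -> M) :
  (forall s t, rel s t -> mod_eval g s = mod_eval g t) ->
  exists2 f : presented_module -> M, module_hom f &
    forall x, f (mod_class (Mgen x)) = g x.
Proof.
move=> grel.
have geq s t : mod_eq s t -> mod_eval g s = mod_eval g t.
  elim=> {s t} /=; do ?by move=> *; congruence.
  - exact: grel.
  - by move=> *; rewrite addrA.
  - by move=> *; rewrite addrC.
  - by move=> *; rewrite add0r.
  - by move=> *; rewrite scaleN1r addNr.
  - by move=> *; rewrite scalerA.
  - by move=> *; rewrite scale1r.
  - by move=> *; rewrite scalerDr.
  - by move=> *; rewrite scalerDl.
  - by move=> *; rewrite actDl.
  - by move=> *; rewrite actDr.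
  - by move=> *; rewrite actZl.
  - by move=> *; rewrite actZr.
  - by move=> *; rewrite scaleN1r act_bracket.
pose f (m : presented_module) := mod_eval g (repr m).
have fE t : f (mod_class t) = mod_eval g t by apply: geq; apply: mod_repr_class.
exists f => [|x]; last exact: fE.
split=> [k|x]; elim/mod_class_ind=> s; last by rewrite -mod_class_act !fE.
by elim/mod_class_ind=> t; rewrite -mod_classZ -mod_classD !fE.
Qed.

End ModulePresentation.

Arguments Mzero {K L X}.
Arguments Mgen {K L X} _.

Notation ix1 := (ord0 : 'I_2).
Notation ix2 := (ord_max : 'I_2).

(** [A(b, a, c, d)], with rows [(-b, -a)] and [(-c, -d)]. *)
Definition bkm_matrix (K : fieldType) (b a c d : nat) : 'M[K]_2 :=
  \matrix_(i, j) - (if i == ix1 then if j == ix1 then b else a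
                    else if j == ix1 then c else d)%:R.

Record realization (K : fieldType) (A : 'M[K]_2) := Realization {
  cartan : vectType K;
  sroot : 'I_2 -> 'Hom(cartan, K^o);
  coroot : 'I_2 -> cartan;
  dim_cartan : \dim {:cartan} = (4 - \rank A)%N;
  free_sroot : free [seq sroot i | i : 'I_2];
  free_coroot : free [seq coroot i | i : 'I_2];
  sroot_coroot : forall i j, sroot j (coroot i) = A i j
}.

Section BKM.
Variables (K : fieldType) (A : 'M[K]_2) (r : realization A).

Definition weight := 'Hom(cartan r, K^o).

Inductive bkm_gen :=
| Gh of cartan r
| Ge of 'I_2
| Gf of 'I_2.

(** [bkm_rel_lin] makes the Cartan subalgebra map linearly into the algebra.
    There are no Serre relations: this presents the Borcherds-Kac-Moody algebra
    only when every entry of [A] is negative. *)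
Inductive bkm_rel : lie_term K bkm_gen -> lie_term K bkm_gen -> Prop :=
| bkm_rel_lin (k : K) (h h' : cartan r) :
    bkm_rel (Lgen (Gh (k *: h + h')))
            (Ladd (Lscale k (Lgen (Gh h))) (Lgen (Gh h')))
| bkm_rel_hh (h h' : cartan r) :
    bkm_rel (Lbracket (Lgen (Gh h)) (Lgen (Gh h'))) Lzero
| bkm_rel_he (h : cartan r) i :
    bkm_rel (Lbracket (Lgen (Gh h)) (Lgen (Ge i)))
            (Lscale (sroot r i h : K) (Lgen (Ge i)))
| bkm_rel_hf (h : cartan r) i :
    bkm_rel (Lbracket (Lgen (Gh h)) (Lgen (Gf i)))
            (Lscale (- sroot r i h : K) (Lgen (Gf i)))
| bkm_rel_ef i j :
    bkm_rel (Lbracket (Lgen (Ge i)) (Lgen (Gf j)))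
            (if i == j then Lgen (Gh (coroot r i)) else Lzero).

Definition bkm : lieAlgType K := presented_lie bkm_rel.

Definition bkm_h (h : cartan r) : bkm := lie_class bkm_rel (Lgen (Gh h)).
Definition bkm_e (i : 'I_2) : bkm := lie_class bkm_rel (Lgen (Ge i)).
Definition bkm_f (i : 'I_2) : bkm := lie_class bkm_rel (Lgen (Gf i)).

Definition npos : set bkm := generated_subalgebra (range bkm_e).

Definition root_space (beta : weight) : set bkm :=
  [set x | forall h, bracket (bkm_h h) x = (beta h : K) *: x].

Definition weight_space (M : lieModType bkm) (mu : weight) : set M :=
  [set m | forall h, act (bkm_h h) m = (mu h : K) *: m].

(** [verma lambda] is [U(g) (x)_{U(h + n^+)} K_lambda], presented by the image of
    its canonical generator. *)
Inductive verma_rel (lambda : weight) :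
    mod_term bkm unit -> mod_term bkm unit -> Prop :=
| verma_rel_npos x : npos x -> verma_rel lambda (Mact x (Mgen tt)) Mzero
| verma_rel_weight h :
    verma_rel lambda (Mact (bkm_h h) (Mgen tt)) (Mscale (lambda h : K) (Mgen tt)).

Definition verma (lambda : weight) : lieModType bkm :=
  presented_module (verma_rel lambda).

(** The maximal vectors of weight [mu] are the nonzero elements of this space. *)
Definition maximal_space (M : lieModType bkm) (mu : weight) : set M :=
  @weight_space M mu `&` [set m | forall x, npos x -> act x m = 0].

Definition module_homs (M N : lieModType bkm) : set (M -> N) :=
  [set f | module_hom f].

Definition signed_dominant_integral (lambda : weight) : Prop :=
  forall i, exists k : nat, lambda (coroot r i) = A i i / 2%:R * k%:R.

End BKM.

Arguments weight_space {K A r} M mu.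
Arguments maximal_space {K A r} M mu.
Arguments module_homs {K A r} M N.

(* Main.v *)
(** The algebra [U(n^-)] is free on [f_o, f_o'], so with [G_i = ad(f_o')^i f_o] a Verma module
    has the basis [G_(i_1) ... G_(i_X) f_o'^k v] (Lazard elimination).  As a module over the
    sl2-triple of [o'] it is a tensor product, so the vectors killed by [e_o'] in degree
    [(2, n)] form a space of dimension [n + 1] on which the exchange [s] of the two letters
    acts, with trace 1 or 0 according to the parity of [n].  By the quadratic condition on
    [(X, Y)] the operator [e_o] becomes there [P (1 + s) / 2 + N (1 - s) / 2], where [N], a
    positive number minus the Casimir of the first two factors, commutes with [s] and is
    triangular with nonzero diagonal, while [P], the difference of the two other Casimirs,
    anticommutes with [s].  Hence the kernel of [e_o] has the dimension of the [s]-symmetric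
    part, which is [ceil ((n + 1) / 2)].  In degree [(3, 3)] the same reduction leaves a
    10 x 10 system; a 6 x 6 minor is [36 (B + 6 c + 3 D) (B + 3 c + D) > 0], independently
    of [lambda], and the four remaining equations are consequences.

    The root spaces are spanned by left-normed brackets, which in these low degrees reduce to
    brackets of the [ad(e_o')^i e_o]; the latter are seen to be independent by letting their
    images under the Chevalley involution act on a highest weight vector. *)

From HB Require Import structures.
Require Import Defs.
From mathcomp Require Import all_boot all_order all_algebra.
From mathcomp Require Import boolp classical_sets functions reals complex.
From mathcomp Require Import ring zify.

Set Implicit Arguments.
Unset Strict Implicit.
Unset Printing Implicit Defensive.

Import Order.TTheory GRing.Theory Num.Theory.
Local Open Scope ring_scope.

(** * Dimensions of subspaces *)

Section Dimension.
Variable K : fieldType.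

(** Passes between abstract modules and coordinates: [g] restricts to a bijection from [S] onto
    [S'], so a basis of [S'] lifts to one of [S]. *)
Lemma has_dim_transfer (V W : lmodType K) (g : V -> W) (S : set V) (S' : set W) n :
  linear g -> S 0 -> (forall k x y, S x -> S y -> S (k *: x + y)) ->
  (forall x, S x -> S' (g x)) -> (forall y, S' y -> exists2 x, S x & g x = y) ->
  (forall x, S x -> g x = 0 -> x = 0) ->
  has_dim S' n -> has_dim S n.
Proof.
move=> lin_g S0 S_lin gS S'g g_inj [b' [b'_free b'_span]].
pose L := GRing.isLinear.Build K V W _ g lin_g.
pose gL : {linear V -> W} := HB.pack g L.
have b'S i : S' (b' i).
  apply/b'_span; exists (fun j => (j == i)%:R).
  by rewrite (bigD1 i) //= eqxx scale1r big1 ?addr0 // => j /negbTE->; rewrite scale0r.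
have /choice[b bP] i : exists x, S x /\ g x = b' i.
  by have [x Sx gx] := S'g _ (b'S i); exists x.
have Ssum (k : 'I_n -> K) : S (\sum_i k i *: b i).
  elim/big_rec: _ => // i x _; apply: S_lin; exact: (bP i).1.
have gsum (k : 'I_n -> K) : g (\sum_i k i *: b i) = \sum_i k i *: b' i.
  rewrite -[g]/(gL : V -> W) linear_sum; apply: eq_bigr => i _.
  by rewrite linearZ /= (bP i).2.
exists b; split=> [k /(congr1 g)|v].
  by rewrite gsum -[g]/(gL : V -> W) linear0 => /b'_free.
split=> [Sv|[k ->]]; last exact: Ssum.
have /b'_span[k gv] := gS _ Sv.
exists k; apply/eqP; rewrite -subr_eq0; apply/eqP; apply: g_inj.
  by rewrite -scaleN1r addrC; apply: S_lin.
by rewrite -[g]/(gL : V -> W) linearB /= -[g _ - _]/(g v - g _) gv gsum subrr.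
Qed.

Lemma has_dim_kernel m n (T : 'M[K]_(m, n)) :
  has_dim [set u : 'rV_m | u *m T = 0] (m - \rank T).
Proof.
rewrite -mxrank_ker; pose B := row_base (kermx T).
have sumE (k : 'I_(\rank (kermx T)) -> K) : \sum_i k i *: row i B = \row_i k i *m B.
  by rewrite mulmx_sum_row; apply: eq_bigr => i _; rewrite mxE.
exists (fun i => row i B); split=> [k|v].
  rewrite sumE => kB i; suff /rowP/(_ i): \row_j k j = 0 by rewrite !mxE.
  by apply: (row_free_inj (row_base_free (kermx T))); rewrite /= mul0mx.
split=> [/= /sub_kermxP|[k ->] /=].
  rewrite -(eq_row_base (kermx T)) => /submxP[u ->].
  by exists (u 0); rewrite sumE; congr (_ *m _); apply/rowP=> i; rewrite mxE.
by rewrite sumE; apply/sub_kermxP; rewrite -(eq_row_base (kermx T)) submxMl.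
Qed.

Lemma linear_rV_mx m n (f : 'rV[K]_m -> 'rV[K]_n) :
  linear f -> exists M, forall u, u *m M = f u.
Proof.
move=> lin_f; pose L := GRing.isLinear.Build K _ _ _ f lin_f.
pose fL : {linear 'rV[K]_m -> 'rV[K]_n} := HB.pack f L.
by exists (lin1_mx fL) => u; rewrite mul_rV_lin1.
Qed.

(** In the full-rank factorization [col_base P *m row_base P], idempotency makes the product in
    reverse order an identity matrix, and the trace does not see the order. *)
Lemma mxtrace_idempotent n (P : 'M[K]_n) : P *m P = P -> \tr P = (\rank P)%:R.
Proof.
move=> PP; rewrite -{1}(mulmx_base P) mxtrace_mulC.
have /row_fullP[C CP] := col_base_full P.
have CPE : C *m P = row_base P by rewrite -[RHS]mul1mx -CP -mulmxA mulmx_base.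
suff -> : row_base P *m col_base P = 1%:M by rewrite mxtrace1.
apply: (row_free_inj (row_base_free P)).
by rewrite /= mul1mx -mulmxA mulmx_base -CPE -mulmxA PP.
Qed.

End Dimension.

(** * Weights with two letters o *)

(** For natural [x] this is the sum of [u + v * j] over [j < x]: the scalar with which a raising
    operator takes the [x]-th rung of an sl2-string to the preceding one. *)
Definition quad (K : fieldType) (u v x : K) : K := u * x + v * (x * (x - 1) / 2).

Section TwoLetters.
Variables (K : numFieldType) (B c D p : K) (n : nat).
Hypotheses (B_gt0 : 0 < B) (c_gt0 : 0 < c) (D_gt0 : 0 < D).

Local Notation tau i := (quad c D i%:R).
Local Notation theta := (quad p D).
Local Notation N := (n%:R : K).

(* [z i j] is the coefficient of [G_i G_j f_o'^(n-i-j)] times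
   [tau_i! * tau_j!]; [sol2 z] says that [e_o'] kills the vector.  Then [z] is
   determined by the free sequence [z 0], from which [casc2] recovers it. *)
Fixpoint casc2 (R : nat -> K) (i j : nat) : K :=
  if i is i'.+1 then - casc2 R i' j.+1 - theta (N - i'%:R - j%:R) * casc2 R i' j
  else R j.

Definition sol2 (z : nat -> nat -> K) : Prop :=
  (forall i j, (n < i + j)%N -> z i j = 0) /\
  (forall i j, z i.+1 j + z i j.+1 + theta (N - i%:R - j%:R) * z i j = 0).

Definition swap2 (z : nat -> nat -> K) i j := z j i.

(* [casimir12] is [B - C_12] and [casimir_diff] is [C_23 - C_13], where [C_uv] is the
   Casimir operator of the sl2-triple of the simple root [o'] on the factors [u] and [v]
   of the tensor product (ad-orbit of [f_o]) x (ad-orbit of [f_o]) x (Verma module);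
   [C_13 + C_23 + C_12] is a scalar on the solutions, which yields [raise2_casimir]. *)
Definition casimir12 (z : nat -> nat -> K) i j : K :=
  (B + quad (2 * c) D (i%:R + j%:R)) * z i j
  + theta (N - i%:R - j%:R + 1) * (tau i * z i.-1 j + tau j * z i j.-1).

Definition casimir_diff (z : nat -> nat -> K) i j : K :=
  tau i * z i.-1 j.+1 - tau j * z i.+1 j.-1 + z i j.+1 - z i.+1 j
  + (quad (p + c) D (N - j%:R) - quad (p + c) D (N - i%:R)) * z i j.

Lemma quad0 (u v : K) : quad u v 0 = 0.
Proof. by rewrite /quad; field. Qed.

Lemma quad_gt0 (u v : K) i : 0 < u -> 0 < v -> 0 < quad u v i.+1%:R.
Proof.
move=> u0 v0; apply: ltr_wpDr; last by rewrite mulr_gt0 ?ltr0n.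
rewrite !mulr_ge0 ?invr_ge0 ?ler0n ?(ltW v0) //.
by rewrite -(natrB K (isT : 1 <= i.+1)%N) ler0n.
Qed.

Lemma casc2_lin k (R R' : nat -> K) i j :
  casc2 (fun m => k * R m + R' m) i j = k * casc2 R i j + casc2 R' i j.
Proof. by elim: i j => //= i IH j; rewrite !IH; ring. Qed.

Lemma casc2_sol R : (forall m, (n < m)%N -> R m = 0) -> sol2 (casc2 R).
Proof.
move=> R0; split; last by move=> i j /=; ring.
elim=> [|i IH] j ij /=; first exact: R0.
rewrite IH ?addnS // oppr0 sub0r; apply/eqP; rewrite oppr_eq0 mulf_eq0.
(* On the diagonal [i + j = n] the coefficient is [theta 0 = 0]; beyond it the induction hypothesis
   applies. *)
move: ij; rewrite addSn ltnS leq_eqVlt => /orP[/eqP->|/IH->]; last by rewrite eqxx orbT.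
by rewrite natrD -addrA -opprD subrr quad0 eqxx.
Qed.

Lemma sol2E z : sol2 z ->
  forall i j, z i.+1 j = - z i j.+1 - theta (N - i%:R - j%:R) * z i j.
Proof. by case=> _ zE i j; have /eqP := zE i j; rewrite -addrA addr_eq0 => /eqP->; ring. Qed.

Lemma sol2_eq0 z : sol2 z -> (forall m, (m <= n)%N -> z 0%N m = 0) -> forall i j, z i j = 0.
Proof.
move=> zS z0; elim=> [|i IH] j; last by rewrite (sol2E zS) !IH mulr0 subr0 oppr0.
by have [/z0//|jn] := leqP j n; case: zS => zout _; apply: zout.
Qed.

Lemma sol2_casc z : sol2 z -> casc2 (z 0%N) = z.
Proof.
move=> zS; apply/funext; elim=> [|i IH]; first by [].
by apply/funext => j /=; rewrite IH (sol2E zS).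
Qed.

Lemma sol2_swap z : sol2 z -> sol2 (swap2 z).
Proof.
case=> z0 zE; split=> i j; first by rewrite addnC; apply: z0.
by rewrite /swap2 -[RHS](zE j i) /quad; field.
Qed.

(** [C_12] commutes with [e_o'], hence preserves the vectors killed by [e_o']. On coefficients this
    is a polynomial identity once [sol2E] has lowered the first index. *)
Lemma casimir12_sol z : sol2 z -> sol2 (casimir12 z).
Proof.
move=> zS; have zE := sol2E zS; case: zS => z0 _; split=> [i j ij|i j].
  rewrite /casimir12 z0 // mulr0 add0r.
  (* Just outside the support the shifted terms carry the factor [theta 0 = 0]; further out they
     vanish themselves. *)
  have [nij|ij'] := eqVneq n.+1 (i + j)%N.
    suff -> : N - i%:R - j%:R + 1 = 0 by rewrite quad0 mul0r.
    by rewrite -[N - _ - _]addrA -opprD -natrD -nij -addn1 natrD; ring.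
  have {}ij : (n.+1 < i + j)%N by rewrite ltn_neqAle ij'.
  suff [-> ->] : tau i * z i.-1 j = 0 /\ tau j * z i j.-1 = 0 by rewrite addr0 mulr0.
  split; [case: i ij {ij'} => [|m] ij | case: j ij {ij'} => [|m] ij]; rewrite ?quad0 ?mul0r //=;
    by rewrite z0 ?mulr0 //; move: ij; rewrite ?addSn ?addnS.
rewrite /casimir12; case: i j => [|i] [|j] /=; rewrite ?zE ?quad0; rewrite /quad -?natr1.
- by field.
- by field.
- by field.
- by field.
Qed.

(** The same for [C_23 - C_13], since [e_o'] commutes with each Casimir operator. *)
Lemma casimir_diff_sol z : sol2 z -> sol2 (casimir_diff z).
Proof.
move=> zS; have zE := sol2E zS; case: zS => z0 _; split=> [i j ij|i j].
  rewrite /casimir_diff (z0 i j) // (z0 i j.+1) ?addnS ?leqW // (z0 i.+1 j) ?addSn ?leqW //.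
  suff [-> ->] : tau i * z i.-1 j.+1 = 0 /\ tau j * z i.+1 j.-1 = 0 by rewrite mulr0 !subr0 !addr0.
  split; [case: i ij => [|m] ij | case: j ij => [|m] ij]; rewrite ?quad0 ?mul0r //=;
    by rewrite z0 ?mulr0 //; move: ij; rewrite ?addSn ?addnS.
rewrite /casimir_diff; case: i j => [|i] [|j] /=; rewrite ?zE ?quad0; rewrite /quad -?natr1.
- by field.
- by field.
- by field.
- by field.
Qed.

Lemma casimir12_swap z : casimir12 (swap2 z) = swap2 (casimir12 z).
Proof. by apply/funext=> i; apply/funext=> j; rewrite /casimir12 /swap2 /quad; field. Qed.

(** Exchanging the first two tensor factors exchanges [C_13] and [C_23]. *)
Lemma casimir_diff_swap z i j :
  casimir_diff (swap2 z) i j = - swap2 (casimir_diff z) i j.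
Proof. by rewrite /casimir_diff /swap2 /quad; field. Qed.

(** On the row [i = 0] the operator is triangular in [m], with diagonal entries
    [B + quad (2 * c) D m > 0]. *)
Lemma casimir12_inj z : sol2 z -> (forall m, casimir12 z 0%N m = 0) -> forall m, z 0%N m = 0.
Proof.
case=> z0 _ Nz; elim=> [|m IH].
  move: (Nz 0%N); rewrite /casimir12 /= !(addr0, quad0, mul0r, mulr0) => /eqP.
  by rewrite mulf_eq0 gt_eqF // => /eqP.
move: (Nz m.+1); rewrite /casimir12 /= quad0 mul0r IH add0r !(mulr0, addr0, add0r) => /eqP.
rewrite mulf_eq0 gt_eqF => [/eqP //|]; apply: addr_gt0 => //; apply: quad_gt0 => //.
exact: mulr_gt0.
Qed.

(* [raise2 p1 z m] is [(c / a) * tau_m!] times the coefficient of [G_m f_o'^(n-m)] in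
   [e_o x], for [x] with rescaled coefficients [z] (see [coords2_raise]). *)
Definition raise2 (p1 : K) (z : nat -> nat -> K) m : K :=
  (p1 + c * (N - m%:R)) * z m 0%N - z m 1%N
  + (p1 + B + c * N) * z 0%N m - tau m * z 1%N m.-1 - z 1%N m.

(** The quadratic condition, in the form of the hypothesis on [p1], turns [e_o] into Casimir
    operators: the symmetric part of [z] enters only through [casimir_diff], the antisymmetric part
    only through [casimir12]. *)
Lemma raise2_casimir p1 z m : sol2 z -> 2 * p1 + B = - (2 * c * N + theta N) ->
  2 * raise2 p1 z m = casimir_diff (fun i j => z i j + swap2 z i j) 0 m
     + casimir12 (fun i j => z i j - swap2 z i j) 0 m.
Proof.
move=> zS Q; have zE := sol2E zS; have zE' := sol2E (sol2_swap zS).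
have -> : p1 = - (2 * c * N + theta N + B) / 2.
  by apply: (mulfI (_ : 2 != 0)); rewrite ?pnatr_eq0 // -[2 * p1](addrK B) Q; field.
move: zE'; rewrite /swap2 => zE'.
rewrite /raise2 /casimir_diff /casimir12 /swap2; case: m => [|m] /=.
  rewrite ?zE ?zE' ?quad0; rewrite /quad -?natr1; by field.
rewrite (zE 0%N) (zE' 0%N) (zE 0%N) (zE' 0%N) ?quad0; rewrite /quad -?natr1; by field.
Qed.

Definition extend_rV (u : 'rV[K]_n.+1) m : K :=
  if (m < n.+1)%N then u 0 (inord m) else 0.

Local Notation cascade u := (casc2 (extend_rV u)).

Definition truncate (R : nat -> K) : 'rV[K]_n.+1 := \row_m R m.

Lemma truncateK R : (forall m, (n < m)%N -> R m = 0) -> extend_rV (truncate R) = R.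
Proof.
move=> R0; apply/funext => m; rewrite /extend_rV; case: ltnP => [mn|/R0->//].
by rewrite mxE inordK.
Qed.

Lemma extend_rVK u : truncate (extend_rV u) = u.
Proof. by apply/rowP=> i; rewrite mxE /extend_rV ltn_ord inord_val. Qed.

Lemma cascade_sol u : sol2 (cascade u).
Proof. by apply: casc2_sol => m nm; rewrite /extend_rV ltnNge nm. Qed.

Lemma cascade_truncate z : sol2 z -> cascade (truncate (z 0%N)) = z.
Proof.
by move=> zS; rewrite truncateK; [exact: sol2_casc|case: zS => z0 _ m; apply: (z0 0%N)].
Qed.

Lemma cascade_lin k u v i j :
  cascade (k *: u + v) i j = k * cascade u i j + cascade v i j.
Proof.
rewrite -casc2_lin; congr casc2; apply/funext=> m; rewrite /extend_rV.
by case: ifP => _; rewrite ?mxE // mulr0 addr0.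
Qed.

(** The [theta] terms only involve cells with index sum below [i0], where everything is zero; what
    remains is one sign per step. At [j = 0] this gives the diagonal of the exchange of letters. *)
Lemma cascade_delta (i0 : 'I_n.+1) i j :
  (i + j <= i0)%N -> cascade (delta_mx 0 i0) i j = (-1) ^+ i * (i + j == i0)%N%:R.
Proof.
elim: i j => [|i IH] j ij /=.
  rewrite mul1r /extend_rV ifT; last exact: leq_ltn_trans ij (ltn_ord i0).
  rewrite mxE eqxx -val_eqE /= inordK //; exact: leq_ltn_trans ij (ltn_ord i0).
rewrite !IH ?addnS ?addSn //; last exact: ltnW.
by rewrite (ltn_eqF ij) !mulr0 subr0 exprS mulN1r mulNr ?addnS.
Qed.

Lemma sum_sign m : \sum_(i < m) (-1) ^+ i = (odd m)%:R :> K.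
Proof.
elim: m => [|m IH]; first by rewrite big_ord0.
by rewrite big_ord_recr /= IH -signr_odd; case: (odd m); rewrite /= ?expr0 ?expr1 ?subrr ?add0r.
Qed.

Theorem raise2_kernel_dim p1 : 2 * p1 + B = - (2 * c * N + theta N) ->
  has_dim [set u : 'rV[K]_n.+1 | forall m, (m <= n)%N -> raise2 p1 (cascade u) m = 0]
          (uphalf n.+1).
Proof.
move=> Q.
(* Rows of length [n.+1] hold the free sequence [z 0] and matrices act on the right: [S] exchanges
   the letters, [P] is [casimir12], [M] is [casimir_diff] and [T] is [raise2]. *)
have [S SE] : exists S, forall u, u *m S = truncate (fun m => cascade u m 0%N).
  by apply: linear_rV_mx => k u v; apply/rowP=> m; rewrite !mxE cascade_lin.
have [P PE] : exists P, forall u, u *m P = truncate (casimir12 (cascade u) 0%N).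
  by apply: linear_rV_mx => k u v; apply/rowP=> m; rewrite !mxE /casimir12 !cascade_lin; ring.
have [M ME] : exists M, forall u, u *m M = truncate (casimir_diff (cascade u) 0%N).
  by apply: linear_rV_mx => k u v; apply/rowP=> m; rewrite !mxE /casimir_diff !cascade_lin; ring.
have [T TE] : exists T, forall u, u *m T = truncate (raise2 p1 (cascade u)).
  by apply: linear_rV_mx => k u v; apply/rowP=> m; rewrite !mxE /raise2 !cascade_lin; ring.
have eqmxE (A A' : 'M[K]_n.+1) : (forall u : 'rV_n.+1, u *m A = u *m A') -> A = A'.
  by move=> AA'; apply/row_matrixP=> i; rewrite !rowE.
have swapS u : cascade (u *m S) = swap2 (cascade u).
  by rewrite SE -[fun m => _]/(swap2 (cascade u) 0%N) cascade_truncate //;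
    apply/sol2_swap/cascade_sol.
have SS : S *m S = 1%:M.
  apply: eqmxE => u; rewrite mulmxA SE swapS mulmx1; exact: extend_rVK.
have SP : S *m P = P *m S.
  apply: eqmxE => u; rewrite !mulmxA PE swapS SE PE cascade_truncate.
    by rewrite casimir12_swap.
  exact/casimir12_sol/cascade_sol.
have SM : S *m M = - M *m S.
  apply: eqmxE => u; rewrite !mulmxA mulmxN mulNmx !ME swapS SE.
  rewrite cascade_truncate; last exact/casimir_diff_sol/cascade_sol.
  by apply/rowP=> m; rewrite !mxE casimir_diff_swap.
have Pfree : row_free P.
  apply/inj_row_free => u; rewrite PE => /rowP Pu.
  rewrite -(extend_rVK u); apply/rowP=> m; rewrite !mxE.
  apply: (casimir12_inj (cascade_sol u)) => {}m.
  have [mn|nm] := ltnP m n.+1; first by have := Pu (Ordinal mn); rewrite !mxE.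
  by have [->] := casimir12_sol (cascade_sol u).
(* The projections onto symmetric and antisymmetric solutions. *)
pose E := 2^-1 *: (1%:M + S); pose F := 2^-1 *: (1%:M - S).
have EF1 : E + F = 1%:M.
  rewrite -scalerDr addrACA subrr addr0 -mulr2n -scaler_nat scalerA mulVf ?scale1r //.
  by rewrite pnatr_eq0.
have EE : E *m E = E.
  rewrite -scalemxAl -scalemxAr mulmxDl mul1mx mulmxDr mulmx1 SS [S + _]addrC.
  by rewrite -mulr2n -scaler_nat [2^-1 *: (2 *: _)]scalerA mulVf ?pnatr_eq0 ?scale1r.
have FE : F = 1%:M - E by rewrite -EF1 addrC addKr.
have FF : F *m F = F by rewrite FE mulmxBr mulmx1 mulmxBl mul1mx EE subrr subr0.
have FE0 : F *m E = 0 by rewrite FE mulmxBl mul1mx EE subrr.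
have FP : F *m P = P *m F.
  by rewrite -scalemxAl -scalemxAr mulmxBl mulmxBr mul1mx mulmx1 SP.
have EM : E *m M = M *m F.
  by rewrite -scalemxAl -scalemxAr mulmxBr mulmxDl mul1mx mulmx1 SM mulNmx.
have TEF : T = E *m M + F *m P.
  apply: (scalerI (_ : 2 != 0)); first by rewrite pnatr_eq0.
  rewrite scalerDr -!scalemxAl !scalerA divff ?pnatr_eq0 // !scale1r.
  apply: eqmxE => u; rewrite -scalemxAr TE mulmxDr !mulmxA mulmxBr mulmxDr mulmx1.
  rewrite ME PE; apply/rowP=> m; rewrite !mxE raise2_casimir //; last exact: cascade_sol.
  congr (_ + _); first congr casimir_diff; last congr casimir12.
    apply/funext=> i; apply/funext=> j.
    by rewrite -[X in cascade (X + _)]scale1r cascade_lin mul1r swapS.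
  apply/funext=> i; apply/funext=> j.
  by rewrite [u - _]addrC -scaleN1r cascade_lin swapS mulN1r addrC.
(* [T = T F] bounds the rank of [T] by that of [F]; [F T = F P] with [P] invertible gives the
   reverse bound. *)
have TF : T = T *m F by rewrite TEF mulmxDl EM -!mulmxA FF -FP mulmxA FF.
have FT : F *m T = F *m P.
  by rewrite TEF mulmxDr mulmxA FE0 mul0mx add0r mulmxA FF.
have rankT : \rank T = \rank F.
  apply/eqP; rewrite eqn_leq {1}TF mxrankM_maxr /=.
  by rewrite -(mxrankMfree F Pfree) -FT mxrankM_maxr.
have rankF : (\rank F)%:R = (n.+1./2)%:R :> K.
  rewrite -(mxtrace_idempotent FF) mxtraceZ linearB /= mxtrace1.
  (* The diagonal entries of [S] are [(-1) ^+ i], and the alternating sum is [0] or [1]. *)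
  have -> : \tr S = (odd n.+1)%:R.
    rewrite -sum_sign; apply: eq_bigr => i _.
    have := congr1 (fun u : 'rV_n.+1 => u 0 i) (SE (delta_mx 0 i)).
    by rewrite -rowE !mxE cascade_delta ?addn0 // eqxx mulr1.
  apply: (mulfI (_ : 2 != 0)); first by rewrite pnatr_eq0.
  rewrite mulrA divff ?pnatr_eq0 // mul1r -{1}(odd_double_half n.+1) natrD addrC addKr.
  by rewrite -muln2 natrM mulrC.
have -> : uphalf n.+1 = (n.+1 - \rank T)%N.
  move/eqP: rankF; rewrite eqr_nat rankT => /eqP->.
  by rewrite uphalf_half -[X in (X - _)%N]odd_double_half -addnn addnA addnK.
have [b [b_free b_span]] := has_dim_kernel T; exists b; split=> // u.
rewrite -b_span /= TE; split=> [Tu|/rowP Tu m mn]; last first.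
  by have := Tu (Ordinal (mn : m < n.+1)%N); rewrite !mxE.
by apply/rowP=> m; rewrite !mxE Tu // -ltnS.
Qed.

End TwoLetters.

(** * Weights with three letters o *)

Section ThreeLetters.
Variables (K : numFieldType) (B c D p : K) (n : nat).

Local Notation tau i := (quad c D i%:R).
Local Notation theta := (quad p D).
Local Notation N := (n%:R : K).

Fixpoint casc3 (R : nat -> nat -> K) (i j k : nat) : K :=
  if i is i'.+1 then
    - casc3 R i' j.+1 k - casc3 R i' j k.+1
    - theta (N - i'%:R - j%:R - k%:R) * casc3 R i' j k
  else R j k.

Definition sol3 (z : nat -> nat -> nat -> K) : Prop :=
  (forall i j k, (n < i + j + k)%N -> z i j k = 0) /\
  (forall i j k, z i.+1 j k + z i j.+1 k + z i j k.+1
                 + theta (N - i%:R - j%:R - k%:R) * z i j k = 0).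

(** [A o' o / A o o'] times [tau_j! * tau_k!] times the coefficient of [G_j G_k f_o'^(n-j-k)] in
    [e_o x]; see [coords3_raise]. *)
Definition raise3 (p1 : K) (z : nat -> nat -> nat -> K) j k : K :=
  (p1 + 2 * B + c * N) * z 0%N j k
  - tau j * z 1%N j.-1 k - tau k * z 1%N j k.-1 - z 1%N j k
  + (p1 + B + c * (N - j%:R)) * z j 0%N k - tau k * z j 1%N k.-1 - z j 1%N k
  + (p1 + c * (N - j%:R - k%:R)) * z j k 0%N - z j k 1%N.

Lemma sol3E z : sol3 z -> forall i j k,
  z i.+1 j k = - z i j.+1 k - z i j k.+1 - theta (N - i%:R - j%:R - k%:R) * z i j k.
Proof. by case=> _ zE i j k; have /eqP := zE i j k; rewrite -!addrA addr_eq0 => /eqP->; ring. Qed.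

Lemma sol3_eq0 z : sol3 z -> (forall j k, z 0%N j k = 0) -> forall i j k, z i j k = 0.
Proof.
by move=> zS z0; elim=> [|i IH] j k; rewrite ?z0 // (sol3E zS) !IH mulr0 !subr0 oppr0.
Qed.

Lemma casc3_sol R : (forall j k, (n < j + k)%N -> R j k = 0) -> sol3 (casc3 R).
Proof.
move=> R0; split; last by move=> i j k /=; ring.
elim=> [|i IH] j k ijk /=; first exact: R0.
rewrite (IH j.+1) ?(IH _ k.+1) ?addnS ?addSn // !oppr0 !add0r; apply/eqP.
rewrite oppr_eq0 mulf_eq0.
move: ijk; rewrite !addSn ltnS leq_eqVlt => /orP[/eqP->|/IH->]; last by rewrite eqxx orbT.
by rewrite (_ : _%:R - _ - _ - _ = 0) ?quad0 ?eqxx // !natrD; ring.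
Qed.

End ThreeLetters.

(** * The linear system in degree (3, 3) *)

Section DegreeThreeThree.
Variables (K : numFieldType) (B c D p p1 : K).
Hypotheses (B_gt0 : 0 < B) (c_gt0 : 0 < c) (D_gt0 : 0 < D).
Hypothesis p1E : p1 = - (B + 3 * c + p + D).

Let u_neq0 : B + 3 * c + D != 0.
Proof. by rewrite gt_eqF // !addr_gt0 ?mulr_gt0 ?ltr0n. Qed.

Let v_neq0 : B + 6 * c + 3 * D != 0.
Proof. by rewrite gt_eqF // !addr_gt0 ?mulr_gt0 ?ltr0n. Qed.

(** Six of the ten equations, in the order (1,0), (0,1), (0,2), (1,1), (0,3), (3,0), determine the
    six other entries of the slice [z 0]. *)
Lemma raise3_inj z : sol3 D p 3 z ->
  (forall j k, (j + k <= 3)%N -> raise3 B c D 3 p1 z j k = 0) ->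
  z 0%N 0%N 0%N = 0 -> z 0%N 0%N 1%N = 0 -> z 0%N 1%N 0%N = 0 -> z 0%N 2%N 0%N = 0 ->
  forall j k, z 0%N j k = 0.
Proof.
move=> zS rz r00 r01 r10 r20; have zE := sol3E zS; have [z0 _] := zS.
have zero m (y : K) : m%:R * y = 0 -> (0 < m)%N -> y = 0.
  by move=> /eqP; rewrite mulf_eq0 pnatr_eq0 => /orP[/eqP->//|/eqP].
(* The difference of the equations (1,0) and (0,1), in which [z 0 0 2] cancels. *)
have e10 : 4 * z 0%N 1%N 1%N = 0.
  rewrite -[RHS]addr0 -[X in _ = X + _](rz 1%N 0%N) // -[X in _ = _ + X]oppr0 -(rz 0%N 1%N) //.
  by rewrite /raise3 /= !zE !(r00, r01, r10, r20) /quad p1E; field.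
have r11 := zero _ _ e10 isT.
have r02 : z 0%N 0%N 2%N = 0.
  by rewrite -[RHS](rz 0%N 1%N) // /raise3 /= !zE !(r00, r01, r10, r11) /quad p1E; field.
have r21 : z 0%N 2%N 1%N = z 0%N 0%N 3%N.
  apply/eqP; rewrite -subr_eq0 -oppr_eq0 -[X in _ == X](rz 0%N 2%N) //; apply/eqP.
  by rewrite /raise3 /= !zE !(r00, r01, r10, r11, r20, r02) /quad p1E; field.
have r12 : z 0%N 1%N 2%N = - z 0%N 0%N 3%N.
  apply/eqP; rewrite -addr_eq0; apply/eqP/(zero 3) => //.
  rewrite -[RHS](rz 1%N 1%N) //.
  by rewrite /raise3 /= !zE !(r00, r01, r10, r11, r20, r02, r21) /quad p1E; field.
(* Entries of index sum 4 appear when [zE] unfolds the last two equations; they lie outside the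
   support. *)
have [z04 z13 z22 z31 z40] : [/\ z 0%N 0%N 4%N = 0, z 0%N 1%N 3%N = 0, z 0%N 2%N 2%N = 0, z 0%N
  3%N 1%N = 0
  & z 0%N 4%N 0%N = 0] by rewrite !z0.
have e03 : (B + 3 * c + D - 2 * p) * z 0%N 0%N 3%N - (B + 3 * c + D + p) * z 0%N 3%N 0%N = 0.
  rewrite -[RHS](rz 0%N 3%N) //.
  by rewrite /raise3 /= !zE !(r00, r01, r10, r11, r20, r02, r21, r12, z04, z13, z22, z31, z40)
    /quad p1E; field.
have e30 : (B + 9 * c + 5 * D + 2 * p) * z 0%N 0%N 3%N
           + (2 * B + 9 * c + 4 * D + p) * z 0%N 3%N 0%N = 0.
  rewrite -[RHS](rz 3%N 0%N) //.
  by rewrite /raise3 /= !zE !(r00, r01, r10, r11, r20, r02, r21, r12, z04, z13, z22, z31, z40)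
    /quad p1E; field.
(* Cramer's rule for the remaining unknowns [z 0 0 3] and [z 0 3 0]: the parameter [p] drops out of
   the determinant, which is a product of positive factors. *)
have cramer (y a b a' b' : K) : a = 0 -> b = 0 ->
    a' * a + b' * b = 3%:R * ((B + 3 * c + D) * (B + 6 * c + 3 * D)) * y -> y = 0.
  move=> -> ->; rewrite !mulr0 addr0 => /esym/eqP.
  by rewrite !mulf_eq0 pnatr_eq0 (negbTE u_neq0) (negbTE v_neq0) => /eqP.
have r03 : z 0%N 0%N 3%N = 0.
  by apply: (cramer _ _ _ (2 * B + 9 * c + 4 * D + p) (B + 3 * c + D + p) e03 e30); ring.
have r30 : z 0%N 3%N 0%N = 0.
  by apply: (cramer _ _ _ (- (B + 9 * c + 5 * D + 2 * p)) (B + 3 * c + D - 2 * p) e03 e30); ring.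
move=> [|[|[|[|j]]]] [|[|[|[|k]]]] //; rewrite ?r21 ?r12 ?r03 ?oppr0 //; exact: z0.
Qed.

Lemma raise3_surj r00 r01 r10 r20 : exists z,
  [/\ sol3 D p 3 z, forall j k, (j + k <= 3)%N -> raise3 B c D 3 p1 z j k = 0
    & [/\ z 0%N 0%N 0%N = r00, z 0%N 0%N 1%N = r01, z 0%N 1%N 0%N = r10
        & z 0%N 2%N 0%N = r20]].
Proof.
pose r02 : K := - (3 * (D + p) * (B + 6 * c + 2 * D + 2 * p) * r00
   + (4 * B + 6 * c + 4 * p) * r01 + (2 * p - B) * r10 + 2 * r20) / 4.
pose r11 : K := 3 * c * (D + p) * r00 + (B + c - D) * r01 - (B + c + D + p) * r10 + r02.
(* [w21] and [w12] are the inhomogeneous parts of [r21 = r03 + w21] and [r12 = w12 - r03]. Below,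
   [s1] and [s2] are the right-hand sides of the 2 x 2 system for [r03] and [r30], and [d] is its
   determinant. *)
pose w21 : K := (2 * c * D + 4 * c * p + D ^+ 2 + 2 * D * p) * r01
  + (B + 2 * c - D - p) * r02 - (B + 2 * c + D + p) * r20.
pose w12 : K := - ((2 * c * D + 4 * c * p + D ^+ 2 + 3 * D * p + 2 * p ^+ 2) * r01
  + (B * D + 2 * B * p + 4 * c * D + 8 * c * p + D ^+ 2 + 3 * D * p + 2 * p ^+ 2) * r10
  + (2 * c + D + p) * r02 + (2 * B + 6 * c + D + 4 * p) * r11
  + (B + 4 * c + D + p) * r20) / 3 - w21.
pose s1 : K := - (3 * (c + D) * p * r02).
pose t : K := 3 * p * (B * D + 2 * B * p + 6 * c * D + 12 * c * p + 2 * D ^+ 2 + 6 * D * p + 4 *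
  p ^+ 2).
pose s2 : K := - (t * ((D + p) * r00 + r01 + r10)
  + 3 * (B + 6 * c + 2 * D + 2 * p) * (p * r02 + 2 * p * r11 + w12)
  + (3 * B + 21 * c + 9 * D + 6 * p) * (p * r20 + w21)).
pose d : K := 3 * (B + 3 * c + D) * (B + 6 * c + 3 * D).
pose r03 : K := ((2 * B + 9 * c + 4 * D + p) * s1 + (B + 3 * c + D + p) * s2) / d.
pose r30 : K := ((B + 3 * c + D - 2 * p) * s2 - (B + 9 * c + 5 * D + 2 * p) * s1) / d.
pose r21 : K := r03 + w21.
pose r12 : K := w12 - r03.
pose R (j k : nat) : K := match j, k with
  | 0%N, 0%N => r00 | 0%N, 1%N => r01 | 1%N, 0%N => r10
  | 0%N, 2%N => r02 | 1%N, 1%N => r11 | 2%N, 0%N => r20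
  | 0%N, 3%N => r03 | 1%N, 2%N => r12 | 2%N, 1%N => r21 | 3%N, 0%N => r30
  | _, _ => 0 end.
exists (casc3 D p 3 R); split=> //.
  by apply: casc3_sol; move=> [|[|[|[|?]]]] [|[|[|[|?]]]].
by move=> [|[|[|[|j]]]] [|[|[|[|k]]]] // _; rewrite /raise3 /= /quad p1E
   /r12 /r21 /r03 /r30 /d /s1 /s2 /t /w12 /w21 /r11 /r02; field; rewrite ?v_neq0 ?u_neq0.
Qed.

End DegreeThreeThree.

(** * A coordinate model of the Verma module *)

Lemma linear_at0 (K : pzRingType) (V W : lmodType K) (f : V -> W) : linear f -> f 0 = 0.
Proof. by move=> /(_ (-1) 0 0); rewrite scaler0 addr0 scaleN1r addNr. Qed.

(** * Actions of a presented Lie algebra by operators *)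

Section PresentedAction.
Variables (K : fieldType) (X : Type) (rel : lie_term K X -> lie_term K X -> Prop).
Variables (V : lmodType K) (g : X -> V -> V).
Hypothesis g_lin : forall x, linear (g x).

Fixpoint term_act (t : lie_term K X) (m : V) : V :=
  match t with
  | Lgen x => g x m
  | Lzero => 0
  | Ladd s t => term_act s m + term_act t m
  | Lscale k s => k *: term_act s m
  | Lbracket s t => term_act s (term_act t m) - term_act t (term_act s m)
  end.

Lemma term_actP t : linear (term_act t).
Proof.
elim: t => [x||s IHs t IHt|l s IHs|s IHs t IHt] k m n /=.
- exact: g_lin.
- by rewrite scaler0 addr0.
- by rewrite IHs IHt scalerDr addrACA.
- by rewrite IHs scalerDr !scalerA mulrC.
- by rewrite IHt IHs IHs IHt opprD addrACA scalerBr.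
Qed.

Lemma term_actD t m n : term_act t (m + n) = term_act t m + term_act t n.
Proof. by rewrite -[m]scale1r term_actP !scale1r. Qed.

Lemma term_act0 t : term_act t 0 = 0.
Proof. exact/linear_at0/term_actP. Qed.

Lemma term_actZ t k m : term_act t (k *: m) = k *: term_act t m.
Proof. by rewrite -[k *: m]addr0 term_actP term_act0 addr0. Qed.

Lemma term_actN t m : term_act t (- m) = - term_act t m.
Proof. by rewrite -scaleN1r term_actZ scaleN1r. Qed.

Hypothesis g_rel : forall s t, rel s t -> term_act s =1 term_act t.

(** Commutators of linear operators satisfy the Lie algebra axioms, so only the defining relations
    have to be verified. *)
Lemma term_act_eq s t : lie_eq rel s t -> term_act s =1 term_act t.
Proof.
have telescope (x y z : V) : x - y + (y - z) = x - z by rewrite addrA subrK.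
(* The pairwise cancellation of the twelve terms of the Jacobi identity. *)
have hexagon (x y z u v w : V) :
    x - y + (u - z) + (z - v + (y - w)) + (w - u + (v - x)) = 0.
  rewrite [z - v + _]addrC [x - y + (u - z) + _]addrACA !telescope addrACA !telescope.
  by rewrite subrr.
elim=> {s t}.
- exact: g_rel.
- by [].
- by move=> s t _ st m; rewrite st.
- by move=> s t u _ st _ tu m; rewrite st tu.
- by move=> s s' t t' _ ss' _ tt' m /=; rewrite ss' tt'.
- by move=> k s s' _ ss' m /=; rewrite ss'.
- by move=> s s' t t' _ ss' _ tt' m /=; rewrite !ss' !tt'.
- by move=> s t u m /=; rewrite addrA.
- by move=> s t m /=; rewrite addrC.
- by move=> s m /=; rewrite add0r.
- by move=> s m /=; rewrite scaleN1r addNr.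
- by move=> k l s m /=; rewrite scalerA.
- by move=> s m /=; rewrite scale1r.
- by move=> k s t m /=; rewrite scalerDr.
- by move=> k l s m /=; rewrite scalerDl.
- by move=> s t u m /=; rewrite term_actD opprD addrACA.
- by move=> s t u m /=; rewrite term_actD opprD addrACA.
- by move=> k s t m /=; rewrite term_actZ scalerBr.
- by move=> k s t m /=; rewrite term_actZ scalerBr.
- by move=> s m /=; rewrite subrr.
- move=> s t u m /=; rewrite !(term_actD, term_actN) !opprB.
  exact: hexagon.
Qed.

Definition presented_act (x : presented_lie rel) : V -> V := term_act (repr x).

Lemma presented_actE t : presented_act (lie_class rel t) =1 term_act t.
Proof. exact/term_act_eq/lie_repr_class. Qed.

Lemma presented_actDl x y m :
  presented_act (x + y) m = presented_act x m + presented_act y m.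
Proof.
by elim/lie_class_ind: x => s; elim/lie_class_ind: y => t; rewrite -lie_classD !presented_actE.
Qed.

Lemma presented_actDr x m n :
  presented_act x (m + n) = presented_act x m + presented_act x n.
Proof. exact: term_actD. Qed.

Lemma presented_actZl (k : K) x m : presented_act (k *: x) m = k *: presented_act x m.
Proof. by elim/lie_class_ind: x => s; rewrite -lie_classZ !presented_actE. Qed.

Lemma presented_actZr (k : K) x m : presented_act x (k *: m) = k *: presented_act x m.
Proof. exact: term_actZ. Qed.

Lemma presented_act_bracket x y m : presented_act (bracket x y) m =
  presented_act x (presented_act y m) - presented_act y (presented_act x m).
Proof.
elim/lie_class_ind: x => s; elim/lie_class_ind: y => t.
by rewrite -lie_class_bracket !presented_actE.
Qed.

End PresentedAction.

(* [o] will be the simple root with coefficient 2 in part (A1): the cases (2, n) and (n, 2)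
   are [o = ix1] and [o = ix2]. *)
Definition other (i : 'I_2) : 'I_2 := if i == ix1 then ix2 else ix1.

Lemma other_eqF i : (other i == i) = false.
Proof. by rewrite /other; case: i => [[|[|//]] ?]. Qed.

Lemma eq_other i j : j != i -> j = other i.
Proof.
by move=> /eqP ji; apply: val_inj; case: i j ji => [[|[|//]] ?] [[|[|//]] ?] // [];
  apply: val_inj.
Qed.

Lemma weightP (K : fieldType) (A : 'M[K]_2) (r : realization A) (mu : weight r) (c : K) h h' :
  (mu (c *: h + h') : K) = c * (mu h : K) + (mu h' : K).
Proof. by rewrite linearP. Qed.

(** * The generators as operators on coefficient functions *)

Section FockModel.
Variables (K : numFieldType) (A : 'M[K]_2) (r : realization A) (o : 'I_2) (lam : weight r).

Local Notation o' := (other o).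
Local Notation al := (fun h => sroot r o h : K).
Local Notation al' := (fun h => sroot r o' h : K).
Local Notation vec := (seq nat -> nat -> K^o).

(* [x s k] is the coefficient of [G_(s_1) ... G_(s_X) f_o'^k v] in a vector of the Verma
   module, where [G_i = ad(f_o')^i f_o] and [v] is the highest weight vector.  Infinite
   supports are allowed, since every generator acts row-finitely.  The action follows from
   [e_o', G_(i+1)] = tau_(i+1) G_i, [e_o, G_0] = h_o, [e_o, G_1] = A o o' f_o', all other
   [e_o, G_i] being 0. *)
Definition slice i (x : vec) : vec := fun s => x (i :: s).

Definition tau i : K := quad (- A o' o) (- A o' o') i%:R.
Definition theta k : K := quad (lam (coroot r o') : K) (- A o' o') k%:R.
Definition wt h s k : K := (lam h : K) - (size s)%:R * al h - (sumn s + k)%:R * al' h.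

Definition fock_f (x : vec) : vec := fun s k => if s is 0%N :: s' then x s' k else 0.

(** By [[f_o', G_i] = G_(i+1)], a word starting with [i.+1] receives the coefficient of the word
    starting with [i]; otherwise [f_o'] passes the first letter. *)
Fixpoint fock_f'_at (s : seq nat) (x : vec) (k : nat) : K :=
  if s is i :: s' then
    (if i is i'.+1 then x (i' :: s') k else 0) + fock_f'_at s' (slice i x) k
  else if k is k'.+1 then x [::] k' else 0.

Definition fock_f' (x : vec) : vec := fun s k => fock_f'_at s x k.

Arguments fock_f' : simpl never.

Definition fock_h h (x : vec) : vec := fun s k => wt h s k * x s k.

Fixpoint fock_e'_at (s : seq nat) (x : vec) (k : nat) : K :=
  if s is i :: s' then
    tau i.+1 * x (i.+1 :: s') k + fock_e'_at s' (slice i x) k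
  else theta k.+1 * x [::] k.+1.

Definition fock_e' (x : vec) : vec := fun s k => fock_e'_at s x k.

(** The word [s] receives [h_o] applied to the rest of a word with first letter [G_0], then
    [A o o' f_o'] applied to the rest of one with first letter [G_1], and finally the terms in which
    [e_o] passes the first letter. *)
Fixpoint fock_e_at (s : seq nat) (x : vec) (k : nat) : K :=
  wt (coroot r o) s k * x (0%N :: s) k + A o o' * fock_f' (slice 1 x) s k
  + (if s is i :: s' then fock_e_at s' (slice i x) k else 0).

Definition fock_e (x : vec) : vec := fun s k => fock_e_at s x k.

Lemma slice_lin i k x y : slice i (k *: x + y) = k *: slice i x + slice i y.
Proof. by []. Qed.

Lemma fock_fP : linear fock_f.
Proof.
move=> k x y; apply/funext=> -[|[|i] s]; apply/funext=> m //=; rewrite /fock_f /=;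
  by rewrite !fctE ?scaler0 ?addr0.
Qed.

Lemma vecE (k : K) (x y : vec) s m : (k *: x + y) s m = k * x s m + y s m.
Proof. by []. Qed.

Lemma fock_f'P : linear fock_f'.
Proof.
move=> k x y; apply/funext=> s; apply/funext=> m; rewrite vecE /fock_f'.
elim: s x y => [|i s IH] x y /=; first by case: m => [|m] /=; rewrite ?mulr0 ?addr0.
by rewrite slice_lin IH; case: i => [|i]; rewrite ?vecE; ring.
Qed.

Lemma fock_hP h : linear (fock_h h).
Proof. by move=> k x y; apply/funext=> s; apply/funext=> m; rewrite vecE /fock_h vecE; ring. Qed.

Lemma fock_e'P : linear fock_e'.
Proof.
move=> k x y; apply/funext=> s; apply/funext=> m; rewrite vecE /fock_e'.
elim: s x y => [|i s IH] x y /=; rewrite ?slice_lin ?IH ?vecE; ring.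
Qed.

Lemma fock_eP : linear fock_e.
Proof.
move=> k x y; apply/funext=> s; apply/funext=> m; rewrite vecE /fock_e.
by elim: s x y => [|i s IH] x y /=; rewrite !slice_lin fock_f'P ?IH !vecE; ring.
Qed.

(* [fock_h h] plus the scalar [C]: slicing off a letter only changes [C]. *)
Definition shifted_h C h (x : vec) : vec := fun s k => (C + wt h s k) * x s k.

Lemma slice_shifted_h C h i x :
  slice i (shifted_h C h x) = shifted_h (C - al h - i%:R * al' h) h (slice i x).
Proof.
apply/funext=> s; apply/funext=> k; rewrite /slice /shifted_h /wt /=.
by congr (_ * _); rewrite -natr1 -addnA natrD; ring.
Qed.

Lemma fock_hE h x : fock_h h x = shifted_h 0 h x.
Proof. by apply/funext=> s; apply/funext=> k; rewrite /shifted_h add0r. Qed.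

Lemma fock_f'_shifted_h C h x s k :
  fock_f' (shifted_h C h x) s k = (C + wt h s k + al' h) * fock_f' x s k.
Proof.
rewrite /fock_f'; elim: s C x => [|i s IH] C x /=.
  case: k => [|k]; rewrite ?mulr0 // /shifted_h /wt /= !add0n -natr1; ring.
rewrite slice_shifted_h IH mulrDr; congr (_ + _).
  case: i => [|i]; rewrite ?mulr0 // /shifted_h; congr (_ * _).
  by rewrite /wt /= addSn -[in RHS]natr1; ring.
by congr (_ * _); rewrite /wt /= -[in RHS]natr1 -[in RHS]addnA [in RHS]natrD; ring.
Qed.

Lemma fock_e'_shifted_h C h x s k :
  fock_e' (shifted_h C h x) s k = (C + wt h s k - al' h) * fock_e' x s k.
Proof.
rewrite /fock_e'; elim: s C x => [|i s IH] C x /=.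
  by rewrite /shifted_h /wt /= !add0n -natr1; ring.
rewrite slice_shifted_h IH mulrDr; congr (_ + _).
  by rewrite /shifted_h mulrCA; congr (_ * _); rewrite /wt /= addSn -[in LHS]natr1; ring.
by congr (_ * _); rewrite /wt /= -[in RHS]natr1 -[in RHS]addnA [in RHS]natrD; ring.
Qed.

Lemma fock_e_shifted_h C h x s k :
  fock_e (shifted_h C h x) s k = (C + wt h s k - al h) * fock_e x s k.
Proof.
rewrite /fock_e; elim: s C x => [|i s IH] C x /=; rewrite slice_shifted_h fock_f'_shifted_h.
  rewrite /shifted_h !addr0 mulrDr [LHS]addrC [RHS]addrC; congr (_ + _); rewrite mulrCA.
    by congr (_ * _); ring.
  by congr (_ * _); rewrite /wt /=; ring.
rewrite slice_shifted_h IH [RHS]mulrDr [X in _ = X + _]mulrDr; congr (_ + _ + _).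
- by rewrite /shifted_h mulrCA; congr (_ * _); rewrite /wt /= -!natr1; ring.
- by rewrite mulrCA; congr (_ * _); ring.
- by congr (_ * _); rewrite /wt /= -!natr1 -!addnA !natrD; ring.
Qed.

Definition fock_gen (g : bkm_gen r) : vec -> vec :=
  match g with
  | Gh h => fock_h h
  | Ge i => if i == o then fock_e else fock_e'
  | Gf i => if i == o then fock_f else fock_f'
  end.

Lemma fock_gen_linear g : linear (fock_gen g).
Proof.
case: g => [h|i|i] /=; first exact: fock_hP.
  by case: ifP => _; [exact: fock_eP|exact: fock_e'P].
by case: ifP => _; [exact: fock_fP|exact: fock_f'P].
Qed.

Lemma fock_hD h x s k : fock_h h x s k = wt h s k * x s k.
Proof. by []. Qed.

Lemma wt_lin (c : K) h h' s k : wt (c *: h + h') s k = c * wt h s k + wt h' s k.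
Proof. by rewrite /wt !weightP; ring. Qed.

Lemma vec0 s m : (0 : vec) s m = 0 :> K.
Proof. by []. Qed.

Lemma vecD (x y : vec) s m : (x + y) s m = x s m + y s m.
Proof. by []. Qed.

Lemma vecB (x y : vec) s m : (x - y) s m = x s m - y s m.
Proof. by []. Qed.

Lemma vecZ (k : K) (x : vec) s m : (k *: x) s m = k * x s m.
Proof. by []. Qed.

Lemma comm_h_e h x : fock_h h (fock_e x) - fock_e (fock_h h x) = al h *: fock_e x.
Proof.
apply/funext=> s; apply/funext=> k.
by rewrite vecB vecZ fock_hD [fock_h h x]fock_hE fock_e_shifted_h; ring.
Qed.

Lemma comm_h_e' h x : fock_h h (fock_e' x) - fock_e' (fock_h h x) = al' h *: fock_e' x.
Proof.
apply/funext=> s; apply/funext=> k.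
by rewrite vecB vecZ fock_hD [fock_h h x]fock_hE fock_e'_shifted_h; ring.
Qed.

Lemma comm_h_f h x : fock_h h (fock_f x) - fock_f (fock_h h x) = - al h *: fock_f x.
Proof.
apply/funext=> s; apply/funext=> k; rewrite vecB vecZ /fock_h /fock_f.
case: s => [|[|i] s]; rewrite ?mulr0 ?subr0 //.
by rewrite /wt /= -natr1 add0n; ring.
Qed.

Lemma comm_h_f' h x : fock_h h (fock_f' x) - fock_f' (fock_h h x) = - al' h *: fock_f' x.
Proof.
apply/funext=> s; apply/funext=> k.
by rewrite vecB vecZ fock_hD [fock_h h x]fock_hE fock_f'_shifted_h; ring.
Qed.

Lemma slice_fock_f i x : slice i (fock_f x) = if i is 0%N then x else 0.
Proof. by case: i. Qed.

Lemma fock_f'0 : fock_f' 0 = 0.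
Proof. exact/linear_at0/fock_f'P. Qed.

Lemma slice_fock_f' i x :
  slice i (fock_f' x) = (if i is i'.+1 then slice i' x else 0) + fock_f' (slice i x).
Proof. by case: i. Qed.

Lemma slice_fock_e' i x : slice i (fock_e' x) = tau i.+1 *: slice i.+1 x + fock_e' (slice i x).
Proof. by []. Qed.

Lemma tau0 : tau 0 = 0.
Proof. exact: quad0. Qed.

Lemma comm_e_f x : fock_e (fock_f x) - fock_f (fock_e x) = fock_h (coroot r o) x.
Proof.
apply/funext=> s; apply/funext=> k; rewrite vecB fock_hD /fock_e.
case: s => [|i s] /=; rewrite !slice_fock_f fock_f'0 /fock_f /=;
  first by rewrite mulr0 !addr0 subr0.
case: i => [|i]; rewrite mulr0 addr0 ?addrK //=.
have e0 : fock_e 0 = 0 by exact/linear_at0/fock_eP.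
by rewrite -[fock_e_at s 0 k]/(fock_e 0 s k) e0 addr0 subr0.
Qed.

Lemma comm_e'_f x : fock_e' (fock_f x) - fock_f (fock_e' x) = 0.
Proof.
have e0 : fock_e' 0 = 0 by exact/linear_at0/fock_e'P.
apply/funext=> s; apply/funext=> k; rewrite vecB /fock_e' /fock_f.
case: s => [|i s] /=; first by rewrite mulr0 subr0.
rewrite mulr0 add0r -[fun _ => _]/(fock_f x) slice_fock_f; case: i => [|i]; first exact: subrr.
by rewrite -[fock_e'_at s 0 k]/(fock_e' 0 s k) e0 subr0.
Qed.

Lemma fock_f'_cons x i s k : fock_f' x (i :: s) k =
  (if i is i'.+1 then x (i' :: s) k else 0) + fock_f' (slice i x) s k.
Proof. by []. Qed.

Lemma fock_e'_cons x i s k :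
  fock_e' x (i :: s) k = tau i.+1 * x (i.+1 :: s) k + fock_e' (slice i x) s k.
Proof. by []. Qed.

Lemma fock_e_cons x i s k : fock_e x (i :: s) k =
  wt (coroot r o) (i :: s) k * x [:: 0%N, i & s] k
  + A o o' * fock_f' (slice 1 x) (i :: s) k + fock_e (slice i x) s k.
Proof. by []. Qed.

Lemma comm_e'_f' x : fock_e' (fock_f' x) - fock_f' (fock_e' x) = fock_h (coroot r o') x.
Proof.
have e0 : fock_e' 0 = 0 by exact/linear_at0/fock_e'P.
apply/funext=> s; apply/funext=> k; rewrite vecB fock_hD.
elim: s x => [|i s IH] x.
  rewrite /fock_e' /= /fock_f' /=; case: k => [|k]; rewrite ?subr0 -?mulrBl; congr (_ * _);
    by rewrite /theta /wt /quad /= !sroot_coroot add0n -?natr1; field.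
rewrite fock_e'_cons !fock_f'_cons slice_fock_f' slice_fock_e'.
rewrite -[fock_e' (slice i x)]/(fock_e' (slice i x)) fock_f'P.
rewrite -[X in fock_e' (X + _)]scale1r fock_e'P scale1r !vecE.
have IHi : fock_e' (fock_f' (slice i x)) s k - fock_f' (fock_e' (slice i x)) s k
    = wt (coroot r o') s k * x (i :: s) k := IH (slice i x).
rewrite mulrDr.
(* The letter [G_i] has [h_o']-eigenvalue [tau i.+1 - tau i], exactly what raising and lowering this
   letter in the two orders leaves over. *)
have -> : wt (coroot r o') (i :: s) k = tau i.+1 - tau i + wt (coroot r o') s k.
  by rewrite /wt /tau /quad /= !sroot_coroot -addnA natrD -!natr1; field.
rewrite [RHS]mulrDl -IHi !vecD.
by case: i {IHi} => [|i]; rewrite ?fock_e'_cons ?tau0 ?e0 ?vec0; ring.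
Qed.

Lemma fock_f'D x y : fock_f' (x + y) = fock_f' x + fock_f' y.
Proof. by rewrite -[x]scale1r fock_f'P !scale1r. Qed.

Lemma fock_f'Z c x : fock_f' (c *: x) = c *: fock_f' x.
Proof. by rewrite -[c *: x]addr0 fock_f'P fock_f'0 addr0. Qed.

Lemma fock_eD x y : fock_e (x + y) = fock_e x + fock_e y.
Proof. by rewrite -[x]scale1r fock_eP !scale1r. Qed.

(** Split [e_o] into [lead], which consumes the first letter, and the part that passes it. Inside
    [lead], the commutator of [h_o] with [f_o'] cancels against the term that [f_o'] creates by
    turning [G_0] into [G_1]; the other part is the induction. *)
Lemma comm_e_f' x : fock_e (fock_f' x) - fock_f' (fock_e x) = 0.
Proof.
have e0 : fock_e 0 = 0 by exact/linear_at0/fock_eP.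
pose h1 := coroot r o.
pose lead x : vec := fock_h h1 (slice 0 x) + A o o' *: fock_f' (slice 1 x).
have lead_f' y : lead (fock_f' y) = fock_f' (lead y).
  rewrite /lead !slice_fock_f' add0r !fock_f'D fock_f'Z scalerDr addrA; congr (_ + _).
  have := comm_h_f' h1 (slice 0 y); rewrite sroot_coroot scaleNr => /eqP.
  by rewrite subr_eq => /eqP->; rewrite addrAC addNr add0r.
apply/funext=> s; apply/funext=> k; rewrite vecB; apply/eqP; rewrite subr_eq0; apply/eqP.
elim: s x => [|i s IH] x.
  transitivity (lead (fock_f' x) [::] k); first by rewrite /fock_e /= addr0.
  by rewrite lead_f'; case: k => [|k]; rewrite /fock_f' //= /fock_e /= addr0.
transitivity (lead (fock_f' x) (i :: s) k + fock_e (slice i (fock_f' x)) s k); first by [].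
rewrite lead_f' !fock_f'_cons slice_fock_f' fock_eD vecD IH.
rewrite -[slice i (fock_e x)]/(slice i (lead x) + fock_e (slice i x)) fock_f'D vecD.
by rewrite addrACA; congr (_ + _); case: i => [|i]; rewrite ?e0 ?vec0 ?addr0.
Qed.

Lemma fock_gen_rel s t : bkm_rel s t -> term_act fock_gen s =1 term_act fock_gen t.
Proof.
case=> [k h h'|h h'|h i|h i|i j] x /=.
- by apply/funext=> s'; apply/funext=> m; rewrite vecE /fock_h wt_lin; ring.
- by apply/funext=> s'; apply/funext=> m; rewrite vecB /fock_h mulrCA subrr.
- case: eqP => [->|/eqP/eq_other->]; [exact: comm_h_e|exact: comm_h_e'].
- case: eqP => [->|/eqP/eq_other->]; [exact: comm_h_f|exact: comm_h_f'].
- have [io|/eq_other io] := eqVneq i o; have [jo|/eq_other jo] := eqVneq j o;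
    rewrite ?io ?jo ?eqxx ?other_eqF ?[o == o']eq_sym ?other_eqF /=.
  + exact: comm_e_f.
  + exact: comm_e_f'.
  + exact: comm_e'_f.
  + exact: comm_e'_f'.
Qed.

End FockModel.

Arguments fock_f' : simpl never.

(* The phantom arguments let unification find the module structure, which depends on them. *)
Definition fock (K : numFieldType) (A : 'M[K]_2) (r : realization A)
  (o : 'I_2) (lam : weight r) : Type := seq nat -> nat -> K^o.

Section FockModule.
Variables (K : numFieldType) (A : 'M[K]_2) (r : realization A) (o : 'I_2) (lam : weight r).

HB.instance Definition _ := GRing.Lmodule.on (fock o lam).

Let g_lin := @fock_gen_linear K A r o lam.
Let g_rel := @fock_gen_rel K A r o lam.

HB.instance Definition _ := isLieModule.Build K (bkm r) (fock o lam)
  (presented_actDl g_lin g_rel) (presented_actDr g_lin) (presented_actZl g_lin g_rel)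
  (presented_actZr g_lin) (presented_act_bracket g_lin g_rel).

Local Notation F := (fock o lam).

Lemma fock_actE g (x : F) : act (lie_class (@bkm_rel K A r) (Lgen g)) x = fock_gen o lam g x.
Proof. exact: presented_actE. Qed.

Lemma fock_act_h h (x : F) : act (bkm_h h) x = fock_h o lam h x.
Proof. exact: fock_actE. Qed.

Lemma fock_act_e (x : F) : act (bkm_e r o) x = fock_e o lam x.
Proof. by rewrite fock_actE /= eqxx. Qed.

Lemma fock_act_e' (x : F) : act (bkm_e r (other o)) x = fock_e' o lam x.
Proof. by rewrite fock_actE /= other_eqF. Qed.

Lemma fock_act_f (x : F) : act (bkm_f r o) x = fock_f x.
Proof. by rewrite fock_actE /= eqxx. Qed.

Lemma fock_act_f' (x : F) : act (bkm_f r (other o)) x = fock_f' x.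
Proof. by rewrite fock_actE /= other_eqF. Qed.

End FockModule.

(** * Maximal vectors in coordinates *)

Section FamilySpan.
Variables (K : fieldType) (V : lmodType K) (I : eqType) (F : I -> V).

Definition in_span (x : V) : Prop := exists l : seq (K * I), x = \sum_(t <- l) t.1 *: F t.2.

Lemma in_span0 : in_span 0.
Proof. by exists [::]; rewrite big_nil. Qed.

Lemma in_spanD x y : in_span x -> in_span y -> in_span (x + y).
Proof. by move=> [l ->] [m ->]; exists (l ++ m); rewrite big_cat. Qed.

Lemma in_spanZ k x : in_span x -> in_span (k *: x).
Proof.
move=> [l ->]; exists [seq (k * t.1, t.2) | t <- l]; rewrite big_map scaler_sumr.
by apply: eq_bigr => t _; rewrite scalerA.
Qed.

Lemma in_spanB x y : in_span x -> in_span y -> in_span (x - y).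
Proof. by move=> Sx Sy; rewrite -scaleN1r; apply/in_spanD/in_spanZ. Qed.

Lemma in_span_gen i : in_span (F i).
Proof. by exists [:: (1, i)]; rewrite big_seq1 scale1r. Qed.

Lemma in_span_ind (P : V -> Prop) : P 0 -> (forall x y, P x -> P y -> P (x + y)) ->
  (forall k x, P x -> P (k *: x)) -> (forall i, P (F i)) -> forall x, in_span x -> P x.
Proof.
by move=> P0 PD PZ PF _ [l ->]; elim/big_rec: _ => // t x _ Px; apply: PD => //; apply: PZ.
Qed.

(** All terms sharing the index of the head sum to zero and are filtered out together, which
    shortens the list. *)
Lemma in_span_coef0 (l : seq (K * I)) :
  (forall i, \sum_(t <- l | t.2 == i) t.1 = 0) -> \sum_(t <- l) t.1 *: F t.2 = 0.
Proof.
have [n] := ubnP (size l); elim: n => // n IH in l *.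
case: l => [|[k i] l] ln l0; first by rewrite big_nil.
rewrite (bigID (fun t => t.2 == i)) /= [X in X + _](_ : _ = 0) ?add0r; last first.
  transitivity ((\sum_(t <- (k, i) :: l | t.2 == i) t.1) *: F i).
    by rewrite scaler_suml; apply: eq_bigr => t /eqP->.
  by rewrite l0 scale0r.
rewrite -big_filter; apply: IH => [|j].
  by rewrite /= eqxx /= size_filter (leq_ltn_trans (count_size _ _)).
rewrite big_filter_cond; have [->|ji] := eqVneq j i.
  by rewrite big1 // => t /andP[/negbTE->].
rewrite -[RHS](l0 j); apply: eq_bigl => t; have [->|] := eqVneq t.2 j; rewrite ?andbF ?andbT //.
Qed.

(* Removing the terms with a wrong weight [w i] one at a time with [T h - w i h]. *)
Lemma weight_component (X : Type) (C : eqType) (T : X -> V -> V) (ev : C -> X -> K)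
    (w : I -> C) (c : C) x :
  (forall h, linear (T h)) -> (forall c c', ev c =1 ev c' -> c = c') ->
  (forall i h, T h (F i) = ev (w i) h *: F i) ->
  (forall h, T h x = ev c h *: x) -> in_span x ->
  exists2 l : seq (K * I), all (fun t => w t.2 == c) l & x = \sum_(t <- l) t.1 *: F t.2.
Proof.
move=> T_lin ev_inj TF Tx [l]; have [n] := ubnP (size l); elim: n => // n IH in l *.
have [lc|] := boolP (all (fun t => w t.2 == c) l); first by exists l.
rewrite -has_predC => /hasP[[k i] il /= wic] ln xl.
have [h evh] : exists h, ev (w i) h != ev c h.
  apply: contrapT => /forallNP evE; move/eqP: wic; apply; apply: ev_inj => h.
  by have /negP/negPn/eqP := evE h.
have T0 := linear_at0 (T_lin h).
have TZ a y : T h (a *: y) = a *: T h y by rewrite -[a *: y]addr0 T_lin T0 addr0.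
have TD y z : T h (y + z) = T h y + T h z by rewrite -[y]scale1r T_lin !scale1r.
(* [T h - ev (w i) h] multiplies [x] by [b], so after division by [b] it fixes [x] while killing the
   chosen term. *)
pose b := ev c h - ev (w i) h.
have b0 : b != 0 by rewrite subr_eq0 eq_sym.
pose l' := [seq ((ev (w t.2) h - ev (w i) h) / b * t.1, t.2) | t <- rem (k, i) l].
apply: (IH l'); first by rewrite size_map size_rem // -ltnS prednK //; case: (l) il.
have -> : x = b^-1 *: (T h x - ev (w i) h *: x).
  by rewrite Tx -scalerBl scalerA mulVf ?scale1r.
rewrite big_map; apply: (scalerI b0); rewrite scalerA divff // scale1r scaler_sumr.
transitivity (\sum_(t <- l) (ev (w t.2) h - ev (w i) h) *: (t.1 *: F t.2)).
  rewrite xl scaler_sumr (big_morph (T h) TD T0) -sumrB; apply: eq_bigr => t _.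
  by rewrite TZ TF [RHS]scalerBl !scalerA mulrC.
rewrite (perm_big _ (perm_to_rem il)) big_cons /= subrr scale0r add0r.
apply: eq_bigr => t _; rewrite !scalerA; congr (_ *: _).
by rewrite mulrA [b * _]mulrC divfK.
Qed.

End FamilySpan.

Section ModuleAction.
Variables (K : fieldType) (L : lieAlgType K) (M : lieModType L).

Lemma act_linear (x : L) : linear (act x : M -> M).
Proof. by move=> k m n; rewrite actDr actZr. Qed.

Lemma act0r (x : L) : act x (0 : M) = 0.
Proof. exact/linear_at0/act_linear. Qed.

Lemma act0l (m : M) : act (0 : L) m = 0.
Proof. by rewrite -(scale0r 0) actZl scale0r. Qed.

End ModuleAction.

(** * The monomial basis of the Verma module *)

Section Verma.
Variables (K : numFieldType) (A : 'M[K]_2) (r : realization A) (o : 'I_2).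

Local Notation o' := (other o).
Local Notation al := (fun h => sroot r o h : K).
Local Notation al' := (fun h => sroot r o' h : K).

Lemma ord2P (P : 'I_2 -> Prop) : P o -> P o' -> forall i, P i.
Proof. by move=> Po Po' i; have [->|/eq_other->] := eqVneq i o. Qed.

Lemma sroot_indep (u v : K) :
  (forall h, u * (sroot r o h : K) + v * (sroot r o' h : K) = 0) -> u = 0 /\ v = 0.
Proof.
move=> uv.
have e2 : enum 'I_2 = [:: ix1; ix2].
  by apply: (inj_map val_inj); rewrite val_enum_ord.
have := free_sroot r; rewrite /image_mem e2 /= => fr.
have /freeP/(_ (fun i => if i == o then u else v)) k0 :=
  (fr : free [tuple sroot r ix1; sroot r ix2]).
have comb : \sum_(i < 2) (if i == o then u else v) *: sroot r i = 0.
  rewrite (bigD1 o) //= eqxx (bigD1 o') /=; last by rewrite other_eqF.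
  rewrite other_eqF big1 ?addr0; last first.
    by move=> i /andP[/negP io /negP io']; case: io'; apply/eqP/eq_other/negP.
  by apply/lfunP=> h; rewrite add_lfunE !scale_lfunE zero_lfunE; exact: uv.
have {}k0 : forall i, (if i == o then u else v) = 0.
  apply: k0; rewrite -[RHS]comb !big_ord_recl !big_ord0 /=.
  by rewrite (_ : lift ord0 ord0 = ix2) //; apply: val_inj.
by move: (k0 o) (k0 o'); rewrite other_eqF eqxx.
Qed.

Variable lam : weight r.
Local Notation F := (fock o lam).
Local Notation M := (verma lam).
Local Notation f := (bkm_f r o).
Local Notation f' := (bkm_f r o').

(** The annihilator of a vector is a subalgebra. *)
Lemma npos_kill (N : lieModType (bkm r)) (m : N) :
  (forall i, act (bkm_e r i) m = 0) -> forall x, npos x -> act x m = 0.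
Proof.
move=> em x; elim=> {x} [x [i _ <-]||x y _ xm _ ym|k x _ xm|x y _ xm _ ym].
- exact: em.
- exact: act0l.
- by rewrite actDl xm ym addr0.
- by rewrite actZl xm scaler0.
- by rewrite act_bracket xm ym !act0r subrr.
Qed.

Definition vacuum : M := mod_class (@verma_rel K A r lam) (Mgen tt).

(** The elements [G_i] of the Lazard elimination. *)
Fixpoint ladder i : bkm r := if i is i'.+1 then bracket f' (ladder i') else f.

Definition prepend i (x : F) : F := fun s k => if s is j :: s' then (j == i)%:R * x s' k else 0.

(** Commuting with [f_o'] leaves only the change of the new first letter. This is why monomials
    correspond to the functions [delta p]. *)
Lemma ladder_act i (x : F) : act (ladder i) x = prepend i x.
Proof.
elim: i x => [|i IH] x /=.
  rewrite fock_act_f; apply/funext=> -[|[|j] s]; apply/funext=> k //=; rewrite ?mul1r ?mul0r //.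
rewrite act_bracket !IH !fock_act_f'.
apply/funext=> -[|j s]; apply/funext=> k.
  by rewrite vecB /fock_f' /=; case: k => [|k]; rewrite /= subr0.
rewrite vecB fock_f'_cons.
have -> : slice j (prepend i x) = (j == i)%:R *: x by [].
rewrite fock_f'Z vecZ /= addrK; case: j => [|j]; first by rewrite mul0r.
by rewrite eqSS.
Qed.

Definition monomial (p : seq nat * nat) : M :=
  foldr (fun i m => act (ladder i) m) (iter p.2 (act f') vacuum) p.1.

Definition delta (p : seq nat * nat) : F := fun s k => ((s, k) == p)%:R.

Lemma fock_e_vacuum : fock_e o lam (delta ([::], 0%N)) = 0.
Proof.
have d0 i : slice i (delta ([::], 0%N)) = 0 by [].
apply/funext=> s; apply/funext=> k.
have e0 : fock_e o lam 0 = 0 by exact/linear_at0/fock_eP.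
by case: s => [|i s]; rewrite ?fock_e_cons /fock_e /= -?/(fock_e _ _ _ _ _) !d0 fock_f'0 ?e0
  /delta /= ?mulr0 !addr0.
Qed.

Lemma fock_e'_vacuum : fock_e' o lam (delta ([::], 0%N)) = 0.
Proof.
apply/funext=> s; apply/funext=> k; have e0 := linear_at0 (@fock_e'P K A r o lam).
case: s => [|i s]; first by rewrite /fock_e' /= /delta /= mulr0.
by rewrite fock_e'_cons (_ : slice i _ = 0) // e0 /delta mulr0 addr0.
Qed.

Lemma vacuum_weight h : fock_h o lam h (delta ([::], 0%N)) = (lam h : K) *: delta ([::], 0%N).
Proof.
apply/funext=> s; apply/funext=> k; rewrite /fock_h vecZ /delta.
have [[-> ->]|] := eqVneq (s, k) _; last by rewrite !mulr0.
by rewrite /wt /= addn0 !mul0r !subr0.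
Qed.

Lemma fock_hom : exists2 phi : M -> F, module_hom phi &
  phi vacuum = delta ([::], 0%N).
Proof.
have [|phi phi_hom phiv] := @presented_module_universal K (bkm r) unit (verma_rel lam) F
  (fun=> delta ([::], 0%N)); last by exists phi => //; exact: phiv.
move=> s t [x nx|h] /=; last by rewrite fock_act_h vacuum_weight.
apply: npos_kill nx; elim/ord2P; first by rewrite fock_act_e fock_e_vacuum.
by rewrite fock_act_e' fock_e'_vacuum.
Qed.

Section Hom.
Variables (phi : M -> F).
Hypotheses (phi_hom : module_hom phi) (phi_vacuum : phi vacuum = delta ([::], 0%N)).

Let phi_lin : linear phi. Proof. exact: phi_hom.1. Qed.

Lemma phi_monomial p : phi (monomial p) = delta p.
Proof.
case: p => s k; rewrite /monomial /=; elim: s => [|i s IH] /=.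
  elim: k => [|k IH] /=; first exact: phi_vacuum.
  rewrite phi_hom.2 IH fock_act_f'; apply/funext=> -[|i s]; apply/funext=> m.
    by case: m => [|m]; rewrite /fock_f' /= /delta.
  rewrite fock_f'_cons (_ : slice i _ = 0) // fock_f'0 addr0 /delta; case: i => //.
rewrite phi_hom.2 IH ladder_act; apply/funext=> -[|j t]; apply/funext=> m //=.
by rewrite /delta /= -natrM mulnb !xpair_eqE eqseq_cons andbA.
Qed.

(** Words in the [f_i] applied to the vacuum span a subspace stable under each generator, hence all
    of [M]. They are rewritten as monomials by induction on the word. *)
Lemma monomial_span m : in_span monomial m.
Proof.
have act_span (x : bkm r) (I J : eqType) (F1 : I -> M) (F2 : J -> M) :
    (forall i, in_span F2 (act x (F1 i))) -> forall m, in_span F1 m -> in_span F2 (act x m).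
  move=> xF {}m Fm; elim/in_span_ind: Fm => //.
  - by rewrite act0r; apply: in_span0.
  - by move=> y z Fy Fz; rewrite actDr; apply: in_spanD.
  - by move=> k y Fy; rewrite actZr; apply: in_spanZ.
pose word w := foldr (fun i m => act (bkm_f r i) m) vacuum w.
have word_h h w : exists c : K, act (bkm_h h) (word w) = c *: word w.
  elim: w => [|i w [c IH]] /=.
    exists (lam h); rewrite /vacuum -mod_class_act -mod_classZ; apply/mod_classP.
    exact/Meq_rel/verma_rel_weight.
  exists (- (sroot r i h : K) + c).
  have : act (bracket (bkm_h h) (bkm_f r i)) (word w) = - (sroot r i h : K) *: act (bkm_f r i)
    (word w).
    by rewrite -actZl; congr act; rewrite -lie_class_bracket -lie_classZ;
      apply/lie_classP/Leq_rel/bkm_rel_hf.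
  rewrite act_bracket IH actZr => /eqP; rewrite subr_eq => /eqP->.
  by rewrite scalerDl.
have word_e i w : in_span word (act (bkm_e r i) (word w)).
  elim: w => [|j w IH] /=.
    rewrite (_ : act _ _ = 0); first exact: in_span0.
    rewrite /vacuum -mod_class_act -mod_class0; apply/mod_classP/Meq_rel/verma_rel_npos.
    by apply: gs_gen; exists i.
  have -> : act (bkm_e r i) (act (bkm_f r j) (word w)) =
      act (bracket (bkm_e r i) (bkm_f r j)) (word w) + act (bkm_f r j) (act (bkm_e r i) (word w)).
    by rewrite act_bracket subrK.
  apply: in_spanD; last by apply: act_span IH => w'; apply: (in_span_gen word (j :: w')).
  have -> : bracket (bkm_e r i) (bkm_f r j) = if i == j then bkm_h (coroot r i) else 0.
    rewrite -lie_class_bracket [RHS](_ : _ = lie_class (@bkm_rel K A r)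
      (if i == j then Lgen (Gh (coroot r i)) else Lzero)); last by case: ifP.
    exact/lie_classP/Leq_rel/bkm_rel_ef.
  case: ifP => _; last by rewrite act0l; apply: in_span0.
  by have [c ->] := word_h (coroot r i) w; apply/in_spanZ/in_span_gen.
have word_stable x m' : in_span word m' -> in_span word (act x m').
  elim/lie_class_ind: x => t; elim: t m' => [g||s IHs t IHt|k s IHs|s IHs t IHt] m' Sm.
  - apply: act_span Sm => w; case: g => [h|i|i]; last exact: (in_span_gen word (i :: w)).
      by have [c cE] := word_h h w; rewrite -/(bkm_h h) cE; apply/in_spanZ/in_span_gen.
    exact: word_e.
  - by rewrite lie_class0 act0l; apply: in_span0.
  - by rewrite lie_classD actDl; apply: in_spanD; auto.
  - by rewrite lie_classZ actZl; apply: in_spanZ; auto.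
  - by rewrite lie_class_bracket act_bracket; apply: in_spanB; auto.
have word_all : in_span word m.
  elim/mod_class_ind: m; elim=> [[]||s IHs t IHt|k s IHs|x s IHs].
  - exact: (in_span_gen word [::]).
  - exact: in_span0.
  - by rewrite mod_classD; apply: in_spanD.
  - by rewrite mod_classZ; apply: in_spanZ.
  - by rewrite mod_class_act; apply: word_stable.
(* Moving [f_o'] to the right past [G_i] costs one term with [G_(i+1)]. *)
have mono_f' p : in_span monomial (act f' (monomial p)).
  case: p => s k; elim: s => [|i s IH]; first exact: (in_span_gen monomial ([::], k.+1)).
  have -> : act f' (monomial (i :: s, k)) = monomial (i.+1 :: s, k) + act (ladder i) (act f'
    (monomial (s, k))).
    by rewrite /monomial /= act_bracket subrK.
  apply: in_spanD; first exact: in_span_gen.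
  by apply: act_span IH => -[t l]; apply: (in_span_gen monomial (i :: t, l)).
move: word_all; elim/in_span_ind: m / => [|||w].
- exact: in_span0.
- exact: in_spanD.
- by move=> k x; apply: in_spanZ.
elim: w => [|i w IH]; first exact: (in_span_gen monomial ([::], 0%N)).
elim/ord2P: i => /=; last exact: act_span IH.
by apply: act_span IH => -[s k]; apply: (in_span_gen monomial (0%N :: s, k)).
Qed.

(** The monomials span and their images [delta p] are independent. *)
Lemma phi_inj m : phi m = 0 -> m = 0.
Proof.
have [l ->] := monomial_span m => phi0; apply: in_span_coef0 => -[s k].
transitivity (phi (\sum_(t <- l) t.1 *: monomial t.2) s k); last by rewrite phi0.
elim: l {phi0} => [|[c p] l IH]; first by rewrite !big_nil (linear_at0 phi_lin).
rewrite !big_cons /= phi_lin vecE -IH phi_monomial /delta eq_sym.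
by case: eqP => _; rewrite ?mulr1 ?mulr0 ?add0r.
Qed.

End Hom.

End Verma.

(** A homomorphism out of [verma mu] is determined by the image of the generator, which can be any
    vector of weight [mu] killed by [npos]. *)
Lemma hom_dim (K : fieldType) (A : 'M[K]_2) (r : realization A) (lam mu : weight r) n :
  has_dim (maximal_space (verma lam) mu) n -> has_dim (module_homs (verma mu) (verma lam)) n.
Proof.
pose v : verma mu := mod_class (verma_rel mu) (Mgen tt).
pose ev (F : verma mu -> verma lam) := F v.
have fct0 x : (0 : verma mu -> verma lam) x = 0 by [].
have fctD k (F G : verma mu -> verma lam) x : (k *: F + G) x = k *: F x + G x by [].
apply: (has_dim_transfer (g := ev)) => //.
- by split=> [k x y|x y]; rewrite !fct0 ?scaler0 ?addr0 ?act0r.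
- move=> k F G [F_lin Fact] [G_lin Gact]; split=> [a x y|x y]; rewrite !fctD.
    by rewrite F_lin G_lin !scalerDr !scalerA [k * a]mulrC addrACA.
  by rewrite Fact Gact actDr actZr.
- move=> F [F_lin Fact]; split=> [h|x nx] /=; rewrite /ev.
    have vh : act (bkm_h h) v = (mu h : K) *: v.
      by rewrite -mod_class_act -mod_classZ; apply/mod_classP/Meq_rel/verma_rel_weight.
    by rewrite -Fact vh -[_ *: v]addr0 F_lin (linear_at0 F_lin) addr0.
  have vx : act x v = 0 by rewrite -mod_class_act; apply/mod_classP/Meq_rel/verma_rel_npos.
  by rewrite -Fact vx (linear_at0 F_lin).
- move=> m [/= m_wt m_max].
  have [|F F_hom Fv] := @presented_module_universal K (bkm r) unit (verma_rel mu) (verma lam)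
    (fun=> m).
    by move=> s t [x nx|h] /=; [exact: m_max|exact: m_wt].
  by exists F => //; exact: Fv.
- move=> F [F_lin Fact] Fv; apply/funext; elim/mod_class_ind;
  elim=> [[]||s IHs t IHt|k s IHs|x s IHs].
  + exact: Fv.
  + by rewrite mod_class0 (linear_at0 F_lin).
  + by rewrite mod_classD -[mod_class _ s]scale1r F_lin IHs IHt !fct0 scaler0 addr0.
  + by rewrite mod_classZ -[_ *: _]addr0 F_lin IHs (linear_at0 F_lin) !fct0 scaler0 addr0.
  + by rewrite mod_class_act Fact IHs !fct0 act0r.
Qed.

(** * Maximal vectors inside the model *)

Section Maximal.
Variables (K : numFieldType) (A : 'M[K]_2) (r : realization A) (o : 'I_2) (lam mu : weight r).
Variables X Y : nat.
Local Notation o' := (other o).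
Local Notation F := (fock o lam).
Local Notation M := (verma lam).
Hypothesis mu_def : mu = lam - X%:R *: sroot r o - Y%:R *: sroot r o'.

Definition supported (Z T : nat) (x : F) := forall s k, x s k <> 0 -> size s = Z /\ (sumn s +
  k)%N = T.

Lemma mu_at h : (mu h : K) = (lam h : K) - X%:R * (sroot r o h : K) - Y%:R * (sroot r o' h : K).
Proof. by rewrite mu_def add_lfunE opp_lfunE scale_lfunE add_lfunE opp_lfunE scale_lfunE. Qed.

(** Simple roots are independent, so the weight determines the degree of a word. The offsets [p],
    [q] serve for the images under [e_o] and [e_o']. *)
Lemma eigen_supported (x : F) (p q : nat) :
  (forall h, fock_h o lam h x =
     ((mu h : K) + p%:R * (sroot r o h : K) + q%:R * (sroot r o' h : K)) *: x) ->
  forall s k, x s k <> 0 -> (size s + p)%N = X /\ (sumn s + k + q)%N = Y.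
Proof.
move=> xh s k /eqP x0.
have /(sroot_indep (o := o))[/eqP Xs /eqP Ys] : forall h,
    (X%:R - (size s + p)%:R) * (sroot r o h : K) + (Y%:R - (sumn s + k + q)%:R) * (sroot r o' h :
      K) = 0.
  move=> h; have := congr1 (fun y : F => y s k) (xh h); rewrite fock_hD vecZ mu_at.
  by move/(mulIf x0)/eqP; rewrite -subr_eq0 => /eqP <-; rewrite /wt !natrD; ring.
by move: Xs Ys; rewrite !subr_eq0 !eqr_nat => /eqP<- /eqP<-.
Qed.

Lemma supported_eigen (x : F) h : supported X Y x -> fock_h o lam h x = (mu h : K) *: x.
Proof.
move=> xS; apply/funext=> s; apply/funext=> k; rewrite fock_hD vecZ mu_at.
have [->|/eqP x0] := eqVneq (x s k) 0; first by rewrite !mulr0.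
by have [<- <-] := xS _ _ x0.
Qed.

Lemma supported_e x s k : supported X Y x -> fock_e o lam x s k <> 0 ->
  (size s).+1 = X /\ (sumn s + k)%N = Y.
Proof.
move=> xS xsk; have [h|] := @eigen_supported (fock_e o lam x) 1 0 _ s k xsk;
  last by rewrite addn1 addn0.

have /eqP := comm_h_e o lam h x.
rewrite (supported_eigen _ xS) subr_eq => /eqP->.
have eZ c : fock_e o lam (c *: x) = c *: fock_e o lam x.
  by rewrite -[c *: x]addr0 fock_eP (linear_at0 (@fock_eP _ _ _ _ _)) addr0.
by rewrite eZ mul1r mul0r addr0 scalerDl addrC.
Qed.

Lemma supported_e' x s k : supported X Y x -> fock_e' o lam x s k <> 0 ->
  size s = X /\ (sumn s + k).+1 = Y.
Proof.
move=> xS xsk; have [h|] := @eigen_supported (fock_e' o lam x) 0 1 _ s k xsk;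
  last by rewrite addn0 addn1.

have /eqP := comm_h_e' o lam h x.
rewrite (supported_eigen _ xS) subr_eq => /eqP->.
have eZ c : fock_e' o lam (c *: x) = c *: fock_e' o lam x.
  by rewrite -[c *: x]addr0 fock_e'P (linear_at0 (@fock_e'P _ _ _ _ _)) addr0.
by rewrite eZ mul1r mul0r addr0 scalerDl addrC.
Qed.

Definition highest : set F :=
  [set x | [/\ supported X Y x, fock_e o lam x = 0 & fock_e' o lam x = 0]].

Variable phi : M -> F.
Hypotheses (phi_hom : module_hom phi) (phi_vacuum : phi (vacuum lam) = delta o lam ([::], 0%N)).

Lemma phi_surj x : supported X Y x -> exists m, phi m = x.
Proof.
move=> xS; have phi_lin : linear phi by case: phi_hom.
(* A finite list containing the support: in degree [(X, Y)] the letters and the exponent of [f_o']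
   are at most [Y]. *)
pose D := undup [seq (map val (tval t), k) | t <- enum {: X.-tuple 'I_Y.+1}, k <- iota 0 Y.+1].
exists (\sum_(p <- D) x p.1 p.2 *: monomial o lam p).
have -> : phi (\sum_(p <- D) x p.1 p.2 *: monomial o lam p) = \sum_(p <- D) x p.1 p.2 *: delta o
  lam p.
  elim: D => [|p D IH]; first by rewrite !big_nil (linear_at0 phi_lin).
  by rewrite !big_cons phi_lin IH (phi_monomial phi_hom phi_vacuum).
have sumE (D' : seq (seq nat * nat)) s k :
    (\sum_(p <- D') x p.1 p.2 *: delta o lam p : F) s k = \sum_(p <- D') x p.1 p.2 * (p == (s,
      k))%:R.
  elim: D' => [|p D' IH]; first by rewrite !big_nil.
  by rewrite !big_cons vecE IH /delta eq_sym.
apply/funext=> s; apply/funext=> k; rewrite sumE.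
have [x0|/eqP xsk] := eqVneq (x s k) 0.
  by rewrite x0 big1_seq // => p _; case: eqP => [->|_]; rewrite ?mulr1 ?mulr0.
rewrite (bigD1_seq (s, k)) ?undup_uniq //=; last first.
  have [sX skY] := xS _ _ xsk.
  rewrite mem_undup; apply/allpairsPdep.
  have sY : forall i, i \in s -> (i < Y.+1)%N.
    move=> i si; rewrite ltnS -skY (perm_sumn (perm_to_rem si)) /=.
    by rewrite -addnA leq_addr.
  have sz : size (map (inord : nat -> 'I_Y.+1) s) == X by rewrite size_map sX.
  exists (Tuple sz), k; split.
  - by rewrite mem_enum.
  - by rewrite mem_iota add0n ltnS -skY leq_addl.
  - congr pair; rewrite /= -map_comp map_id_in // => i si /=.
    by rewrite inordK ?sY.
by rewrite eqxx mulr1 big1 ?addr0 // => p /negbTE ->; rewrite mulr0.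
Qed.

(** The model also contains infinite combinations, but vectors of a fixed degree have finite support
    and so come from [M]. *)
Lemma maximal_dim n : has_dim highest n -> has_dim (maximal_space M mu) n.
Proof.
have phi_lin : linear phi by case: phi_hom.
have phiB m m' : phi (m - m') = phi m - phi m'.
  by rewrite addrC -scaleN1r phi_lin scaleN1r addrC.
have inj m m' : phi m = phi m' -> m = m'.
  by move=> mm'; apply/eqP; rewrite -subr_eq0; apply/eqP/(phi_inj phi_hom phi_vacuum);
    rewrite phiB mm' subrr.
apply: (has_dim_transfer (g := phi)) => //.
- by split=> [h|x _] /=; rewrite ?act0r ?scaler0.
- move=> k x y [/= xw xm] [/= yw ym]; split=> [h|z nz] /=; rewrite actDr actZr.
    by rewrite xw yw scalerDr !scalerA mulrC.
  by rewrite xm // ym // scaler0 addr0.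
- move=> m [/= mw mm]; have eg i : act (bkm_e r i) m = 0 by apply/mm/gs_gen; exists i.
  split.
  + move=> s k xsk; have [h|] := @eigen_supported (phi m) 0 0 _ s k xsk; last by rewrite !addn0.
    rewrite !mul0r !addr0 -fock_act_h -phi_hom.2 mw.
    by rewrite -[_ *: m]addr0 phi_lin (linear_at0 phi_lin) addr0.
  + by rewrite -fock_act_e -phi_hom.2 eg (linear_at0 phi_lin).
  + by rewrite -fock_act_e' -phi_hom.2 eg (linear_at0 phi_lin).
- move=> x [xS xe xe']; have [m mx] := phi_surj xS; exists m => //; split=> [h|] /=.
    apply: inj; rewrite phi_hom.2 fock_act_h mx supported_eigen //.
    by rewrite -[_ *: m]addr0 phi_lin (linear_at0 phi_lin) addr0 mx.
  apply: npos_kill; elim/(ord2P (o := o)); apply: inj; rewrite phi_hom.2 mx (linear_at0 phi_lin).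
    by rewrite fock_act_e.
  by rewrite fock_act_e'.
- by move=> m _; exact: (phi_inj phi_hom phi_vacuum).
Qed.

End Maximal.

(** * Rescaled coordinates and the dimensions for two and three letters *)

Section Coordinates.
Variables (K : numFieldType) (A : 'M[K]_2) (r : realization A) (o : 'I_2) (lam : weight r).
Local Notation o' := (other o).
Hypothesis A_neg : forall i j, A i j < 0.

Local Notation F := (fock o lam).
Local Notation c := (- A o' o).
Local Notation D := (- A o' o').
Local Notation p := (lam (coroot r o') : K).
(** Scaling row [o] of [A] by [ratio] makes the matrix symmetric; [B] and [p1] below are scaled
    accordingly. *)
Local Notation ratio := (A o' o / A o o').
Local Notation B := (- (ratio * A o o)).
Local Notation p1 := (ratio * (lam (coroot r o) : K)).

Fixpoint tau_fact m : K := if m is m'.+1 then tau A o m'.+1 * tau_fact m' else 1.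

Lemma tau_gt0 i : 0 < tau A o i.+1.
Proof. by apply: quad_gt0; rewrite oppr_gt0. Qed.

Lemma tau_fact_neq0 m : tau_fact m != 0.
Proof. by elim: m => [|m IH] /=; rewrite ?oner_neq0 // mulf_neq0 // gt_eqF ?tau_gt0. Qed.

Lemma tau1 : tau A o 1 = c.
Proof. by rewrite /tau /quad; field. Qed.

Lemma B_gt0 : 0 < B.
Proof. by rewrite oppr_gt0 nmulr_llt0 ?A_neg // nmulr_rgt0 ?A_neg // invr_lt0 A_neg. Qed.

Lemma ratio_neq0 : ratio != 0.
Proof. by rewrite mulf_neq0 ?invr_eq0 // lt_eqF. Qed.

Section TwoCoordinates.
Variable n : nat.

Definition coords2 (x : F) i j : K :=
  if (i + j <= n)%N then tau_fact i * tau_fact j * x [:: i; j] (n - (i + j))%N else 0.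

Lemma coords2E x i j k : (i + j + k)%N = n -> coords2 x i j = tau_fact i * tau_fact j * x [:: i;
  j] k.
Proof. by move=> ijk; rewrite /coords2 -ijk leq_addr addKn. Qed.

Lemma coords2_gt x i j : (n < i + j)%N -> coords2 x i j = 0.
Proof. by rewrite /coords2 ltnNge => /negbTE->. Qed.

Lemma coords2_lower x i j k : (i + j + k.+1)%N = n ->
  tau_fact i * tau_fact j * fock_e' o lam x [:: i; j] k =
  coords2 x i.+1 j + coords2 x i j.+1 + quad p D (n%:R - i%:R - j%:R) * coords2 x i j.
Proof.
move=> ijk; rewrite !fock_e'_cons /slice /fock_e' /=.
rewrite (@coords2E x i.+1 j k) ?(@coords2E x i j.+1 k) ?(@coords2E x i j k.+1) //; [|lia|lia].
rewrite /theta (_ : n%:R - i%:R - j%:R = k.+1%:R) /=; first by ring.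
by rewrite -ijk !natrD; ring.
Qed.

Lemma coords2_sol x : fock_e' o lam x = 0 -> sol2 D p n (coords2 x).
Proof.
move=> xe; split=> [i j|i j]; first exact: coords2_gt.
have [ijn|nij] := ltnP (i + j) n.
  have nE : (i + j + (n - (i + j)).-1.+1)%N = n by lia.
  by rewrite -(coords2_lower x nE) xe mulr0.
rewrite (@coords2_gt x i.+1 j) ?(@coords2_gt x i j.+1) ?add0r; [|lia|lia].
have [<-|ij] := eqVneq (i + j)%N n; last by rewrite coords2_gt ?mulr0 // ltn_neqAle eq_sym ij.
by rewrite natrD -addrA -opprD subrr quad0 mul0r.
Qed.

Lemma coords2_raise x m k : (m + k)%N = n ->
  ratio * tau_fact m * fock_e o lam x [:: m] k = raise2 B c D n p1 (coords2 x) m.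
Proof.
move=> mk; rewrite fock_e_cons fock_f'_cons /slice /fock_e /fock_f' /= /raise2.
rewrite (@coords2E x m 0 k) ?(@coords2E x 0 m k) ?addn0 ?add0n //.
(* For [k = 0] there is no [f_o'] left to absorb, and [coords2 x m 1] is indeed out of range. *)
have zm1 : coords2 x m 1 = tau_fact m * c * (if k is k'.+1 then x [:: m; 1%N] k' else 0).
  case: k mk => [|k] mk; first by rewrite coords2_gt ?mulr0 //; lia.
  by rewrite (@coords2E x m 1 k) /= ?mulr1 ?tau1 //; lia.
have z1m : coords2 x 1 m = tau_fact m * c * (if k is k'.+1 then x [:: 1%N; m] k' else 0).
  case: k mk {zm1} => [|k] mk; first by rewrite coords2_gt ?mulr0 //; lia.
  by rewrite (@coords2E x 1 m k) /= ?mulr1 ?tau1; [ring|lia].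
have z1m' : tau A o m * coords2 x 1 m.-1
    = tau_fact m * c * (if m is m'.+1 then x [:: 1%N; m'] k else 0).
  case: m mk {z1m zm1} => [|m] mk; first by rewrite tau0 mul0r mulr0.
  by rewrite (@coords2E x 1 m k) /= ?mulr1 ?tau1; [ring|lia].
have -> : quad c D m%:R * coords2 x 1 m.-1 = tau A o m * coords2 x 1 m.-1 by [].
rewrite zm1 z1m z1m' /=.
rewrite /wt !sroot_coroot /= -mk !addn0 !add0n !natrD.
by case: (k) (m) => [|k'] [|m']; rewrite /fock_f' /slice /=; field; rewrite lt_eqF.
Qed.

Definition of_coords2 (z : nat -> nat -> K) : F := fun s k =>
  if s is [:: i; j] then
    if (i + j + k == n)%N then z i j / (tau_fact i * tau_fact j) else 0
  else 0.

Lemma of_coords2_supported z : supported 2 n (of_coords2 z).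
Proof.
move=> [|i [|j [|? ?]]] k //=; rewrite /of_coords2; case: eqP => // <- _.
by rewrite addn0.
Qed.

Lemma of_coords2K z : sol2 D p n z -> coords2 (of_coords2 z) = z.
Proof.
move=> [z0 _]; apply/funext=> i; apply/funext=> j; rewrite /coords2; case: leqP => [ij|/z0->//].
by rewrite /of_coords2 subnKC // eqxx mulrC divfK // mulf_neq0 ?tau_fact_neq0.
Qed.

Lemma coords2_eq0 x : supported 2 n x -> (forall i j, coords2 x i j = 0) -> x = 0.
Proof.
move=> xS x0; apply/funext=> s; apply/funext=> k; rewrite vec0.
have [//|/eqP xsk] := eqVneq (x s k) 0; have := xS _ _ xsk.
case: s xsk => [|i [|j [|? ?]]] xsk [] //= _; rewrite addn0 => ijk.
move: (x0 i j); rewrite (@coords2E x i j k) // => /eqP.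
by rewrite mulf_eq0 mulf_eq0 !(negbTE (tau_fact_neq0 _)) => /eqP.
Qed.

(** The row [coords2 x 0] determines a vector killed by [e_o'], and [e_o] acts on it as [raise2];
    conversely the cascade of any row of the kernel gives such a vector. *)
Lemma highest2_dim (mu : weight r) :
  mu = lam - 2%:R *: sroot r o - n%:R *: sroot r o' ->
  2 * p1 + B = - (2 * c * n%:R + quad p D n%:R) ->
  has_dim (highest 2 n : set F) (uphalf n.+1).
Proof.
move=> mu_def Q.
have c0 : 0 < c by rewrite oppr_gt0.
have D0 : 0 < D by rewrite oppr_gt0.
have := raise2_kernel_dim B_gt0 c0 D0 Q.
apply: (has_dim_transfer (g := fun x => truncate n (coords2 x 0))).
- move=> k x y; apply/rowP=> i; rewrite !mxE /coords2.
  by case: ifP => _; rewrite ?vecE; ring.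
- split; [by []|exact/linear_at0/fock_eP|exact/linear_at0/fock_e'P].
- move=> k x y [xS xe xe'] [yS ye ye']; split.
  + move=> s m; rewrite vecE; have [->|/eqP xsm _] := eqVneq (x s m) 0; last exact: xS.
    by rewrite mulr0 add0r; apply: yS.
  + by rewrite fock_eP xe ye scaler0 addr0.
  + by rewrite fock_e'P xe' ye' scaler0 addr0.
- move=> x [xS xe xe'] m mn /=; rewrite (cascade_truncate (coords2_sol xe')).
  by rewrite -(@coords2_raise x m (n - m)) ?subnKC // xe vec0 mulr0.
- move=> u /= uT; set z := casc2 _ _ _ _ in uT; have zS : sol2 D p n z := cascade_sol _ _ _.
  exists (of_coords2 z); last by rewrite of_coords2K // extend_rVK.
  (* The degree of the images leaves only one-letter words to check for [e_o], and two-letter words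
     for [e_o']. *)
  have S := @of_coords2_supported z; split=> //.
    apply/funext=> s; apply/funext=> k; rewrite vec0.
    have [//|/eqP e0] := eqVneq (fock_e o lam (of_coords2 z) s k) 0.
    case: s e0 (supported_e mu_def S e0) => [|m [|? ?]] //= e0 [] // _; rewrite addn0 => mk.
    case: e0; apply: (mulfI (mulf_neq0 ratio_neq0 (tau_fact_neq0 m))).
    by rewrite (coords2_raise _ mk) of_coords2K // uT ?mulr0 // -mk leq_addr.
  apply/funext=> s; apply/funext=> k; rewrite vec0.
  have [//|/eqP e0] := eqVneq (fock_e' o lam (of_coords2 z) s k) 0.
  case: s e0 (supported_e' mu_def S e0) => [|i [|j [|? ?]]] //= e0 [] // _.
  rewrite addn0 -addnS => ijk.
  case: e0; apply: (mulfI (mulf_neq0 (tau_fact_neq0 i) (tau_fact_neq0 j))).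
  by rewrite (coords2_lower _ ijk) of_coords2K // mulr0; case: zS.
- move=> x [xS xe xe'] /rowP x0; apply: coords2_eq0 => //.
  apply: (sol2_eq0 (coords2_sol xe')) => m mn.
  by have := x0 (Ordinal (mn : m < n.+1)%N); rewrite !mxE.
Qed.

End TwoCoordinates.

Section ThreeCoordinates.
Variable n : nat.

Definition coords3 (x : F) i j l : K :=
  if (i + j + l <= n)%N then
    tau_fact i * tau_fact j * tau_fact l * x [:: i; j; l] (n - (i + j + l))%N else 0.

Lemma coords3E x i j l k : (i + j + l + k)%N = n ->
  coords3 x i j l = tau_fact i * tau_fact j * tau_fact l * x [:: i; j; l] k.
Proof. by move=> ijk; rewrite /coords3 -ijk leq_addr addKn. Qed.

Lemma coords3_gt x i j l : (n < i + j + l)%N -> coords3 x i j l = 0.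
Proof. by rewrite /coords3 ltnNge => /negbTE->. Qed.

Lemma coords3_lower x i j l k : (i + j + l + k.+1)%N = n ->
  tau_fact i * tau_fact j * tau_fact l * fock_e' o lam x [:: i; j; l] k =
  coords3 x i.+1 j l + coords3 x i j.+1 l + coords3 x i j l.+1
  + quad p D (n%:R - i%:R - j%:R - l%:R) * coords3 x i j l.
Proof.
move=> ijk; rewrite !fock_e'_cons /slice /fock_e' /=.
rewrite (@coords3E x i.+1 j l k) ?(@coords3E x i j.+1 l k) ?(@coords3E x i j l.+1 k)
  ?(@coords3E x i j l k.+1) //; [|lia|lia|lia].
rewrite /theta (_ : n%:R - i%:R - j%:R - l%:R = k.+1%:R) /=; first by ring.
by rewrite -ijk !natrD; ring.
Qed.

Lemma coords3_sol x : fock_e' o lam x = 0 -> sol3 D p n (coords3 x).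
Proof.
move=> xe; split=> [i j l|i j l]; first exact: coords3_gt.
have [ijn|nij] := ltnP (i + j + l) n.
  have nE : (i + j + l + (n - (i + j + l)).-1.+1)%N = n by lia.
  by rewrite -(coords3_lower x nE) xe mulr0.
rewrite (@coords3_gt x i.+1 j l) ?(@coords3_gt x i j.+1 l) ?(@coords3_gt x i j l.+1) ?add0r;
  [|lia|lia|lia].
have [<-|ij] := eqVneq (i + j + l)%N n; last by rewrite coords3_gt ?mulr0 // ltn_neqAle eq_sym ij.
rewrite (_ : _%:R - _ - _ - _ = 0) ?quad0 ?mul0r // !natrD; ring.
Qed.

Lemma coords3_raise x j l k : (j + l + k)%N = n ->
  ratio * tau_fact j * tau_fact l * fock_e o lam x [:: j; l] k =
  raise3 B c D n p1 (coords3 x) j l.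
Proof.
move=> jlk; rewrite !fock_e_cons !fock_f'_cons /slice /fock_e /fock_f' /= /raise3.
rewrite (@coords3E x 0 j l k) ?(@coords3E x j 0 l k) ?(@coords3E x j l 0 k) ?addn0 ?add0n //.
have [zjl zjl' zjl''] : [/\ coords3 x 1 j l = tau_fact j * tau_fact l * c *
       (if k is k'.+1 then x [:: 1%N; j; l] k' else 0),
    coords3 x j 1 l = tau_fact j * tau_fact l * c *
       (if k is k'.+1 then x [:: j; 1%N; l] k' else 0)
  & coords3 x j l 1 = tau_fact j * tau_fact l * c *
       (if k is k'.+1 then x [:: j; l; 1%N] k' else 0)].
  case: k jlk => [|k] jlk; first by rewrite !coords3_gt ?mulr0 //; lia.
  rewrite (@coords3E x 1 j l k) ?(@coords3E x j 1 l k) ?(@coords3E x j l 1 k) /= ?mulr1 ?tau1;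
    [by split; ring|lia|lia|lia].
have z1j : quad c D j%:R * coords3 x 1 j.-1 l
    = tau_fact j * tau_fact l * c * (if j is j'.+1 then x [:: 1%N; j'; l] k else 0).
  case: j jlk {zjl zjl' zjl''} => [|j] jlk; first by rewrite quad0 mul0r mulr0.
  by rewrite (@coords3E x 1 j l k) /= ?mulr1 ?tau1 -/(tau A o _); [ring|lia].
have [z1l zj1l] : quad c D l%:R * coords3 x 1 j l.-1
    = tau_fact j * tau_fact l * c * (if l is l'.+1 then x [:: 1%N; j; l'] k else 0)
  /\ quad c D l%:R * coords3 x j 1 l.-1
    = tau_fact j * tau_fact l * c * (if l is l'.+1 then x [:: j; 1%N; l'] k else 0).
  case: l jlk {zjl zjl' zjl'' z1j} => [|l] jlk; first by rewrite quad0 !mul0r mulr0.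
  rewrite (@coords3E x 1 j l k) ?(@coords3E x j 1 l k) /= ?mulr1 ?tau1 -/(tau A o _);
    [by split; ring|lia|lia].
rewrite zjl zjl' zjl'' z1j z1l zj1l.
rewrite /wt !sroot_coroot /= -jlk !addn0 !add0n !natrD.
by case: (k) (j) (l) => [|k'] [|j'] [|l']; rewrite /fock_f' /slice /=; field; rewrite lt_eqF.
Qed.

Definition of_coords3 (z : nat -> nat -> nat -> K) : F := fun s k =>
  if s is [:: i; j; l] then
    if (i + j + l + k == n)%N then z i j l / (tau_fact i * tau_fact j * tau_fact l) else 0
  else 0.

Lemma of_coords3_supported z : supported 3 n (of_coords3 z).
Proof.
move=> [|i [|j [|l [|? ?]]]] k //=; rewrite /of_coords3; case: eqP => // <- _.
by rewrite addn0 !addnA.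
Qed.

Lemma of_coords3K z : sol3 D p n z -> coords3 (of_coords3 z) = z.
Proof.
move=> [z0 _]; apply/funext=> i; apply/funext=> j; apply/funext=> l.
rewrite /coords3; case: leqP => [ij|/z0->//].
by rewrite /of_coords3 subnKC // eqxx mulrC divfK // !mulf_neq0 ?tau_fact_neq0.
Qed.

Lemma coords3_eq0 x : supported 3 n x -> (forall i j l, coords3 x i j l = 0) -> x = 0.
Proof.
move=> xS x0; apply/funext=> s; apply/funext=> k; rewrite vec0.
have [//|/eqP xsk] := eqVneq (x s k) 0; have := xS _ _ xsk.
case: s xsk => [|i [|j [|l [|? ?]]]] xsk [] //= _; rewrite addn0 !addnA => ijk.
move: (x0 i j l); rewrite (@coords3E x i j l k) // => /eqP.
by rewrite !mulf_eq0 !(negbTE (tau_fact_neq0 _)) => /eqP.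
Qed.

End ThreeCoordinates.

Lemma highest3_dim (mu : weight r) :
  mu = lam - 3%:R *: sroot r o - 3%:R *: sroot r o' ->
  p1 = - (B + 3 * c + p + D) -> has_dim (highest 3 3 : set F) 4.
Proof.
move=> mu_def p1E; have B0 := B_gt0.
have c0 : 0 < c by rewrite oppr_gt0.
have D0 : 0 < D by rewrite oppr_gt0.
(* The space of all rows of length 4, seen as the kernel of a zero matrix; its coordinates are the
   four free entries of [raise3_inj]. *)
have := has_dim_kernel (0 : 'M[K]_(4, 1)); rewrite mxrank0 subn0.
pose co (x : F) := coords3 3 x.
pose row4 (z : nat -> nat -> nat -> K) : 'rV[K]_4 :=
  \row_(i < 4) [:: z 0 0 0; z 0 0 1; z 0 1 0; z 0 2 0]%N`_i.
apply: (has_dim_transfer (g := row4 \o co)).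
- have coP k x y i j l : co (k *: x + y) i j l = k * co x i j l + co y i j l.
    by rewrite /co /coords3; case: ifP => _; rewrite ?vecE; ring.
  by move=> k x y; apply/rowP=> -[[|[|[|[|//]]]] ?]; rewrite !mxE /= coP.
- split; [by []|exact/linear_at0/fock_eP|exact/linear_at0/fock_e'P].
- move=> k x y [xS xe xe'] [yS ye ye']; split.
  + move=> s m; rewrite vecE; have [->|/eqP xsm _] := eqVneq (x s m) 0; last exact: xS.
    by rewrite mulr0 add0r; apply: yS.
  + by rewrite fock_eP xe ye scaler0 addr0.
  + by rewrite fock_e'P xe' ye' scaler0 addr0.
- by move=> x _; rewrite /= mulmx0.
- move=> u _; have [z [zS zT [z0 z1 z2 z3]]] := raise3_surj B0 c0 D0 p1E
    (u 0 0) (u 0 1) (u 0 2%:R) (u 0 3%:R).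
  exists (of_coords3 3 z); last first.
    rewrite /= /co of_coords3K //; apply/rowP=> i; rewrite mxE z0 z1 z2 z3.
    by case: i => -[|[|[|[|//]]]] ? /=; congr (u 0 _); apply: val_inj.
  have S := @of_coords3_supported 3 z; split=> //.
    apply/funext=> s; apply/funext=> k; rewrite vec0.
    have [//|/eqP e0] := eqVneq (fock_e o lam (of_coords3 3 z) s k) 0.
    case: s e0 (supported_e mu_def S e0) => [|j [|l [|? ?]]] //= e0 [] // _.
    rewrite addn0 => jlk; case: e0.
    apply: (mulfI (mulf_neq0 (mulf_neq0 ratio_neq0 (tau_fact_neq0 j)) (tau_fact_neq0 l))).
    by rewrite (coords3_raise _ jlk) of_coords3K // zT ?mulr0 // -jlk leq_addr.
  apply/funext=> s; apply/funext=> k; rewrite vec0.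
  have [//|/eqP e0] := eqVneq (fock_e' o lam (of_coords3 3 z) s k) 0.
  case: s e0 (supported_e' mu_def S e0) => [|i [|j [|l [|? ?]]]] //= e0 [] // _.
  rewrite addn0 !addnA -addnS => ijk; case: e0.
  apply: (mulfI (mulf_neq0 (mulf_neq0 (tau_fact_neq0 i) (tau_fact_neq0 j)) (tau_fact_neq0 l))).
  rewrite (@coords3_lower 3 (of_coords3 3 z) _ _ _ _ ijk).
  by rewrite (of_coords3K zS) mulr0; case: zS.
- move=> x [xS xe xe'] /rowP x0; apply: (coords3_eq0 xS).
  have zS : sol3 D p 3 (coords3 3 x) := @coords3_sol 3 x xe'; apply: (sol3_eq0 zS).
  apply: (raise3_inj B0 c0 D0 p1E zS).
  + move=> j l jl; rewrite -(@coords3_raise 3 x j l (3 - (j + l))) ?subnKC //.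
    by rewrite xe vec0 mulr0.
  + by have := x0 0; rewrite !mxE.
  + by have := x0 1; rewrite !mxE.
  + by have := x0 2%:R; rewrite !mxE.
  + by have := x0 3%:R; rewrite !mxE.
Qed.

End Coordinates.

(** * Root spaces *)

Lemma has_dim_basis (K : fieldType) (V : lmodType K) (S : set V) n (b : 'I_n -> V) :
  S 0 -> (forall x y, S x -> S y -> S (x + y)) -> (forall k x, S x -> S (k *: x)) ->
  (forall i, S (b i)) -> (forall x, S x -> in_span b x) ->
  (forall k : 'I_n -> K, \sum_i k i *: b i = 0 -> forall i, k i = 0) -> has_dim S n.
Proof.
move=> S0 SD SZ Sb Ssub b_free; exists b; split=> // v; split=> [/Ssub|[k ->]]; last first.
  by elim/big_rec: _ => // i x _ Sx; apply: SD => //; apply: SZ.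
elim/in_span_ind=> [|x y [k ->] [l ->]|a x [k ->]|i].
- by exists (fun=> 0); rewrite big1 // => i _; rewrite scale0r.
- by exists (fun i => k i + l i); rewrite -big_split; apply: eq_bigr => i _; rewrite scalerDl.
- by exists (fun i => a * k i); rewrite scaler_sumr; apply: eq_bigr => i _; rewrite scalerA.
- exists (fun j => (j == i)%:R); rewrite (bigD1 i) //= eqxx scale1r big1 ?addr0 //.
  by move=> j /negbTE->; rewrite scale0r.
Qed.

(** * Left-normed brackets *)

Section LieAlgebra.
Variables (K : fieldType) (L : lieAlgType K).

Lemma bracket_linearr (x : L) : linear (bracket x).
Proof. by move=> k y z; rewrite bracketDr bracketZr. Qed.

Lemma bracket0r (x : L) : bracket x 0 = 0.
Proof. exact/linear_at0/bracket_linearr. Qed.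

Lemma bracket0l (x : L) : bracket 0 x = 0.
Proof. by have := bracketZl 0 0 x; rewrite !scale0r. Qed.

Lemma bracketC (x y : L) : bracket x y = - bracket y x.
Proof.
apply/eqP; rewrite -addr_eq0; have := bracketxx (x + y).
by rewrite bracketDl !bracketDr !bracketxx add0r addr0 => ->.
Qed.

Lemma bracketNr (x y : L) : bracket x (- y) = - bracket x y.
Proof. by rewrite -scaleN1r bracketZr scaleN1r. Qed.

Lemma bracketA (x y z : L) :
  bracket x (bracket y z) = bracket (bracket x y) z + bracket y (bracket x z).
Proof.
have /eqP := jacobi x y z; rewrite -addrA addr_eq0 => /eqP->.
by rewrite (bracketC z x) bracketNr (bracketC z) opprD !opprK addrC.
Qed.

Lemma in_span_bracket (I J : eqType) (F : I -> L) (F' : J -> L) x :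
  (forall i, in_span F' (bracket x (F i))) ->
  forall y, in_span F y -> in_span F' (bracket x y).
Proof.
move=> xF y Fy; elim/in_span_ind: Fy => // [|y1 y2 S1 S2|k y1 S1].
- by rewrite bracket0r; apply: in_span0.
- by rewrite bracketDr; apply: in_spanD.
- by rewrite bracketZr; apply: in_spanZ.
Qed.

Fixpoint left_normed (x : 'I_2 -> L) (w : seq 'I_2) : L :=
  match w with
  | [::] => 0
  | [:: i] => x i
  | i :: w' => bracket (x i) (left_normed x w')
  end.

Lemma left_normed_cons x i w :
  left_normed x (i :: w) = if w is [::] then x i else bracket (x i) (left_normed x w).
Proof. by case: w. Qed.

Lemma left_normed_stable x i y :
  in_span (left_normed x) y -> in_span (left_normed x) (bracket (x i) y).
Proof.
apply: in_span_bracket => -[|j w]; first by rewrite /= bracket0r; apply: in_span0.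
exact: (in_span_gen (left_normed x) [:: i, j & w]).
Qed.

(* [h] is a torus acting diagonally on the [x i], and [[y j, x i]] lies in it. *)
Lemma left_normed_lower (T : lmodType K) (h : T -> L) (x y : 'I_2 -> L) :
  h 0 = 0 -> (forall t i, exists c : K, bracket (h t) (x i) = c *: x i) ->
  (forall i j, exists t, bracket (y j) (x i) = h t) ->
  forall j w, exists t s, in_span (left_normed x) s /\ bracket (y j) (left_normed x w) = h t + s.
Proof.
move=> h0 hx yx j; have hw t w : exists c : K, bracket (h t) (left_normed x w) = c *: left_normed
  x w.
  elim: w => [|i w [c IH]]; first by exists 0; rewrite bracket0r scaler0.
  rewrite left_normed_cons; case: w IH => [_|i' w IH]; first exact: hx.
  have [c' xE] := hx t i; exists (c' + c).
  by rewrite bracketA IH xE bracketZl bracketZr scalerDl.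
elim=> [|i w [t [s [Ss IH]]]].
  by exists 0, 0; split; [exact: in_span0|rewrite h0 bracket0r addr0].
rewrite left_normed_cons; case: w IH => [_|i' w IH].
  by have [t' ->] := yx i j; exists t', 0; rewrite addr0; split => //; apply: in_span0.
have [t' yxE] := yx i j; have [c bE] := hw t' (i' :: w); have [c' xE] := hx t i.
(* By the Jacobi identity: [[y j, x i]] scales the tail by [c], and the torus part of the induction
   hypothesis scales [x i] by [c']. *)
exists 0, (c *: left_normed x (i' :: w) - c' *: x i + bracket (x i) s).
split.
  apply: in_spanD; last exact: left_normed_stable.
  apply: in_spanB; apply: in_spanZ; first exact: in_span_gen.
  exact: (in_span_gen (left_normed x) [:: i]).
by rewrite h0 add0r bracketA IH yxE bE bracketDr (bracketC (x i) (h t)) xE addrA.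
Qed.

End LieAlgebra.

(** * Spanning sets of the root spaces *)

Section RootSpaces.
Variables (K : numFieldType) (A : 'M[K]_2) (r : realization A) (o : 'I_2).

Local Notation o' := (other o).
Local Notation g := (bkm r).
Local Notation al := (sroot r o).
Local Notation al' := (sroot r o').
Local Notation e := (bkm_e r o).
Local Notation e' := (bkm_e r o').

Lemma bkm_hP : linear (@bkm_h K A r).
Proof.
by move=> k h h'; rewrite /bkm_h -lie_classZ -lie_classD; apply/lie_classP/Leq_rel/bkm_rel_lin.
Qed.

Lemma bkm_he h i : bracket (bkm_h h) (bkm_e r i) = (sroot r i h : K) *: bkm_e r i.
Proof. by rewrite -lie_class_bracket -lie_classZ; apply/lie_classP/Leq_rel/bkm_rel_he. Qed.

Lemma bkm_hf h i : bracket (bkm_h h) (bkm_f r i) = - (sroot r i h : K) *: bkm_f r i.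
Proof. by rewrite -lie_class_bracket -lie_classZ; apply/lie_classP/Leq_rel/bkm_rel_hf. Qed.

Lemma bkm_hh h h' : bracket (bkm_h h) (bkm_h h') = 0 :> g.
Proof. by rewrite -lie_class_bracket -lie_class0; apply/lie_classP/Leq_rel/bkm_rel_hh. Qed.

Lemma bkm_ef i j :
  bracket (bkm_e r i) (bkm_f r j) = bkm_h (if i == j then coroot r i else 0).
Proof.
rewrite -lie_class_bracket (fun_if (@bkm_h K A r)) (linear_at0 bkm_hP) -lie_class0.
rewrite -(fun_if (lie_class (@bkm_rel K A r))); exact/lie_classP/Leq_rel/bkm_rel_ef.
Qed.

Definition root_vector (i : cartan r + seq 'I_2 + seq 'I_2) : g :=
  match i with
  | inl (inl h) => bkm_h h
  | inl (inr w) => left_normed (bkm_e r) w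
  | inr w => left_normed (bkm_f r) w
  end.

Definition content (w : seq 'I_2) : weight r :=
  (count_mem o w)%:R *: al + (count_mem o' w)%:R *: al'.

Definition root_weight (i : cartan r + seq 'I_2 + seq 'I_2) : weight r :=
  match i with inl (inl _) => 0 | inl (inr w) => content w | inr w => - content w end.

Lemma content_cons i w h :
  (content (i :: w) h : K) = (sroot r i h : K) + (content w h : K).
Proof.
rewrite /content !add_lfunE !scale_lfunE /= !natrD.
elim/(ord2P (o := o)): i; rewrite eqxx ?other_eqF ?[o == o']eq_sym ?other_eqF /=;
  rewrite /GRing.scale /=; ring.
Qed.

Lemma root_vector_weight i h :
  bracket (bkm_h h) (root_vector i) = (root_weight i h : K) *: root_vector i.
Proof.
have lnw (x : 'I_2 -> g) (s : K) :
    (forall j, bracket (bkm_h h) (x j) = (s * (sroot r j h : K)) *: x j) ->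
    forall w, bracket (bkm_h h) (left_normed x w) = (s * (content w h : K)) *: left_normed x w.
  move=> hx; elim=> [|j w IH]; first by rewrite bracket0r scaler0.
  rewrite left_normed_cons content_cons; case: w IH => [_|j' w IH].
    by rewrite hx /content !add_lfunE !scale_lfunE /= !scale0r !addr0.
  by rewrite bracketA hx IH bracketZl bracketZr -scalerDl mulrDr.
case: i => [[h'|w]|w] /=.
- by rewrite bkm_hh zero_lfunE scale0r.
- by rewrite (lnw _ 1) ?mul1r // => j; rewrite mul1r bkm_he.
- by rewrite (lnw _ (-1)) ?mulN1r ?opp_lfunE // => j; rewrite mulN1r bkm_hf.
Qed.

(** The span contains the generators and is stable under bracketing with each of them, hence with
    every element. *)
Lemma root_vector_span x : in_span root_vector x.
Proof.
have span_e s : in_span (left_normed (bkm_e r)) s -> in_span root_vector s.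
  elim/in_span_ind=> [|y z|k y|w]; [exact: in_span0|exact: in_spanD|exact: in_spanZ|].
  exact: (in_span_gen root_vector (inl (inr w))).
have span_f s : in_span (left_normed (bkm_f r)) s -> in_span root_vector s.
  elim/in_span_ind=> [|y z|k y|w]; [exact: in_span0|exact: in_spanD|exact: in_spanZ|].
  exact: (in_span_gen root_vector (inr w)).
have h0 := linear_at0 bkm_hP.
have hN (h : cartan r) : bkm_h (- h) = - bkm_h h.
  by have := bkm_hP (-1) h 0; rewrite h0 !addr0 !scaleN1r.
have span_gen (gen : bkm_gen r) (j : cartan r + seq 'I_2 + seq 'I_2) :
    in_span root_vector (bracket (lie_class (@bkm_rel K A r) (Lgen gen)) (root_vector j)).
  case: gen => [h|i|i].
  - by rewrite -/(bkm_h h) root_vector_weight; apply/in_spanZ/in_span_gen.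
  - rewrite -/(bkm_e r i); case: j => [[h|w]|w] /=.
    + by rewrite bracketC bkm_he -scaleNr;
      apply/in_spanZ/(in_span_gen root_vector (inl (inr [:: i]))).
    + exact/span_e/left_normed_stable/in_span_gen.
    + have [||t [s [Ss ->]]] := @left_normed_lower K g _ (@bkm_h K A r) (bkm_f r) (bkm_e r) h0 _
      _ i w.
      * by move=> t j; exists (- sroot r j t : K); rewrite bkm_hf.
      * by move=> j k; rewrite bkm_ef; eexists.
      * by apply: in_spanD (span_f _ Ss); exact: (in_span_gen root_vector (inl (inl t))).
  - rewrite -/(bkm_f r i); case: j => [[h|w]|w] /=.
    + by rewrite bracketC bkm_hf scaleNr opprK;
      apply/in_spanZ/(in_span_gen root_vector (inr [:: i])).
    + have [||t [s [Ss ->]]] := @left_normed_lower K g _ (@bkm_h K A r) (bkm_e r) (bkm_f r) h0 _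
      _ i w.
      * by move=> t j; exists (sroot r j t : K); rewrite bkm_he.
      * by move=> j k; rewrite bracketC bkm_ef -hN; eexists.
      * by apply: in_spanD (span_e _ Ss); exact: (in_span_gen root_vector (inl (inl t))).
    + exact/span_f/left_normed_stable/in_span_gen.
have stable t s : in_span root_vector s -> in_span root_vector (bracket (lie_class (@bkm_rel K A
  r) t) s).
  elim: t s => [gen||t1 IH1 t2 IH2|k t1 IH1|t1 IH1 t2 IH2] s Ss.
  - exact: in_span_bracket Ss.
  - by rewrite lie_class0 bracket0l; apply: in_span0.
  - by rewrite lie_classD bracketDl; apply: in_spanD; auto.
  - by rewrite lie_classZ bracketZl; apply: in_spanZ; auto.
  - rewrite lie_class_bracket -[bracket (bracket _ _) _](addrK (bracket (lie_class _ t2) (bracket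
    (lie_class _ t1) s))).
    by rewrite -bracketA; apply: in_spanB; auto.
elim/lie_class_ind: x; elim=> [[h|i|i]||s IHs t IHt|k s IHs|s IHs t IHt].
- exact: (in_span_gen root_vector (inl (inl h))).
- exact: (in_span_gen root_vector (inl (inr [:: i]))).
- exact: (in_span_gen root_vector (inr [:: i])).
- exact: in_span0.
- by rewrite lie_classD; apply: in_spanD.
- by rewrite lie_classZ; apply: in_spanZ.
- by rewrite lie_class_bracket; apply: stable.
Qed.

(** Projecting a spanning combination to its weight keeps only the [e]-words of the right content:
    [X > 0] excludes the torus and the [f]-words. The coefficient [v] is any scalar, to include
    half-integers. *)
Lemma positive_root_space_ind (X : nat) (v : K) (P : g -> Prop) : (0 < X)%N ->
  P 0 -> (forall x y, P x -> P y -> P (x + y)) -> (forall k x, P x -> P (k *: x)) ->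
  (forall w, count_mem o w = X -> (count_mem o' w)%:R = v -> P (left_normed (bkm_e r) w)) ->
  forall x, root_space (X%:R *: al + v *: al') x -> P x.
Proof.
move=> X0 P0 PD PZ Pw x xb.
have [|||l wl ->] := weight_component (T := fun h => bracket (bkm_h h))
  (ev := fun (mu : weight r) h => mu h : K) (w := root_weight) _ _ _ xb (root_vector_span x).
- by move=> h; exact: bracket_linearr.
- by move=> mu nu mn; apply/lfunP=> h; apply: mn.
- by move=> i h; rewrite root_vector_weight.
elim: l wl => [|[k i] l IH] /=; first by rewrite big_nil.
case/andP=> /eqP iw /IH Pl; rewrite big_cons; apply: PD Pl; apply: PZ => /=.
have indep (a b : K) : X%:R *: al + v *: al' = a *: al + b *: al' -> a = X%:R /\ b = v.
  move=> E; have [] := @sroot_indep K A r o (a - X%:R) (b - v); last first.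
    by move=> /eqP + /eqP; rewrite !subr_eq0 => /eqP-> /eqP->.
  move=> h; have := congr1 (fun mu : weight r => mu h : K) (esym E).
  rewrite !add_lfunE !scale_lfunE /GRing.scale /= => /eqP; rewrite -subr_eq0 => /eqP <-.
  by ring.
case: i iw => [[h|w]|w] /= iw.
- have [] := indep 0 0; first by rewrite !scale0r addr0 iw.
  by move/eqP; rewrite eq_sym pnatr_eq0 => /eqP XE; rewrite XE in X0.
- have [/eqP Xw vw] := indep _ _ (esym iw); apply: Pw => //.
  by move: Xw; rewrite eqr_nat => /eqP.
- have [] := indep (- (count_mem o w)%:R) (- (count_mem o' w)%:R).
    by rewrite -iw /content opprD !scaleNr.
  move/eqP; rewrite eq_sym -addr_eq0 -natrD pnatr_eq0 addn_eq0 => /andP[/eqP XE _].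
  by rewrite XE in X0.
Qed.

Fixpoint ladder_e i : g := if i is i'.+1 then bracket e' (ladder_e i') else e.

Lemma root_space_bracket (beta gamma : weight r) x y :
  root_space beta x -> root_space gamma y -> root_space (beta + gamma) (bracket x y).
Proof.
move=> xb yg h; rewrite bracketA xb yg bracketZl bracketZr -scalerDl.
by rewrite add_lfunE.
Qed.

Lemma root_space_e i : root_space (sroot r i) (bkm_e r i).
Proof. by move=> h; rewrite bkm_he. Qed.

Lemma ladder_root_space i : root_space (al + i%:R *: al') (ladder_e i).
Proof.
elim: i => [|i IH] /=; first by rewrite scale0r addr0; apply: root_space_e.
have -> : al + i.+1%:R *: al' = al' + (al + i%:R *: al') by rewrite -natr1 scalerDl scale1r addrA
  [RHS]addrC.
exact: root_space_bracket (root_space_e _) IH.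
Qed.

Lemma root_space0 (beta : weight r) : root_space beta 0.
Proof. by move=> h; rewrite bracket0r scaler0. Qed.

Lemma root_spaceD (beta : weight r) x y : root_space beta x -> root_space beta y -> root_space
  beta (x + y).
Proof. by move=> xb yb h; rewrite bracketDr xb yb scalerDr. Qed.

Lemma root_spaceZ (beta : weight r) k x : root_space beta x -> root_space beta (k *: x).
Proof. by move=> xb h; rewrite bracketZr xb !scalerA mulrC. Qed.

(** Zero off the degree, so that all pairs can serve as indices. *)
Definition ladder2 n (p : nat * nat) : g :=
  if (p.1 + p.2 == n)%N then bracket (ladder_e p.1) (ladder_e p.2) else 0.

Definition ladder3 n (p : nat * nat * nat) : g :=
  if (p.1.1 + p.1.2 + p.2 == n)%N
  then bracket (ladder_e p.1.1) (bracket (ladder_e p.1.2) (ladder_e p.2)) else 0.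

Local Notation lbr := (left_normed (bkm_e r)).

Lemma count_other_cons w : count_mem o (o' :: w) = count_mem o w /\
  count_mem o' (o' :: w) = (count_mem o' w).+1.
Proof. by rewrite /= other_eqF eqxx. Qed.

Lemma count_self_cons w : count_mem o (o :: w) = (count_mem o w).+1 /\
  count_mem o' (o :: w) = count_mem o' w.
Proof. by rewrite /= [o == o']eq_sym other_eqF eqxx. Qed.

Lemma left_normed0 w : count_mem o w = 0%N -> lbr w = 0 \/ w = [:: o'].
Proof.
elim: w => [|i w IH] //=; first by left.
elim/(ord2P (o := o)): i; rewrite ?eqxx // other_eqF add0n => /IH[w0|->].
  by case: w w0 {IH} => [|j w] w0; [right|left; rewrite w0 bracket0r].
by left; rewrite /= bracketxx.
Qed.

(** A leading [o'] raises the ladder by one; a leading [o] in front of a nonempty tail survives only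
    for the tail [[:: o']], with a sign. *)
Lemma left_normed1 w : count_mem o w = 1%N ->
  exists k : K, lbr w = k *: ladder_e (count_mem o' w).
Proof.
elim: w => // i w IH; elim/(ord2P (o := o)): i.
  have [-> ->] := count_self_cons w => -[w0].
  case: w w0 {IH} => [|j w] w0; first by exists 1; rewrite scale1r.
  rewrite left_normed_cons; have [->|->] := left_normed0 w0.
    by exists 0; rewrite bracket0r scale0r.
  by exists (-1); rewrite /= eqxx scaleN1r [LHS]bracketC.
have [-> ->] := count_other_cons w => w1; have [k wE] := IH w1; exists k.
by case: w w1 wE {IH} => // j w w1 wE; rewrite left_normed_cons wE bracketZr.
Qed.

(** Bracketing with [e_o'] is a derivation, so it keeps the span of brackets of ladder elements and
    raises the degree by one; the same argument serves for three letters. *)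
Lemma left_normed2 w : count_mem o w = 2%N -> in_span (ladder2 (count_mem o' w)) (lbr w).
Proof.
elim: w => // i w IH; elim/(ord2P (o := o)): i.
  have [-> ->] := count_self_cons w => -[w1].
  have [k wE] := left_normed1 w1; case: w w1 wE {IH} => // j w w1 wE.
  rewrite left_normed_cons wE bracketZr; apply: in_spanZ.
  by have := in_span_gen (ladder2 (count_mem o' (j :: w))) (0%N, count_mem o' (j :: w));
    rewrite /ladder2 add0n eqxx.
have [-> ->] := count_other_cons w => w2; have wS := IH w2.
case: w w2 wS {IH} => // j w w2 wS; rewrite left_normed_cons; apply: in_span_bracket wS.
case=> k l; rewrite {2}/ladder2; case: eqP => [kl|_]; last by rewrite bracket0r; apply: in_span0.
rewrite bracketA; apply: in_spanD.
  have := in_span_gen (ladder2 (count_mem o' (j :: w)).+1) (k.+1, l).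
  by rewrite /ladder2 /= addSn kl eqxx.
have := in_span_gen (ladder2 (count_mem o' (j :: w)).+1) (k, l.+1).
by rewrite /ladder2 /= addnS kl eqxx.
Qed.

Lemma left_normed3 w : count_mem o w = 3%N -> in_span (ladder3 (count_mem o' w)) (lbr w).
Proof.
elim: w => // i w IH; elim/(ord2P (o := o)): i.
  have [-> ->] := count_self_cons w => -[w2]; have := left_normed2 w2.
  case: w w2 {IH} => // j w w2; rewrite left_normed_cons; apply: in_span_bracket.
  case=> k l; rewrite /ladder2; case: eqP => [kl|_]; last by rewrite bracket0r; apply: in_span0.
  have := in_span_gen (ladder3 (count_mem o' (j :: w))) (0%N, k, l).
  by rewrite /ladder3 /= add0n kl eqxx.
have [-> ->] := count_other_cons w => w3; have wS := IH w3.
case: w w3 wS {IH} => // j w w3 wS; rewrite left_normed_cons; apply: in_span_bracket wS.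
case=> [[k l] m]; rewrite {2}/ladder3.
case: eqP => [klm|_]; last by rewrite bracket0r; apply: in_span0.
rewrite bracketA [bracket e' (bracket (ladder_e l) _)]bracketA bracketDr.
have gen q : (q.1.1 + q.1.2 + q.2 == (count_mem o' (j :: w)).+1)%N ->
    in_span (ladder3 (count_mem o' (j :: w)).+1)
      (bracket (ladder_e q.1.1) (bracket (ladder_e q.1.2) (ladder_e q.2))).
  by move=> qE; have := in_span_gen (ladder3 (count_mem o' (j :: w)).+1) q; rewrite /ladder3 qE.
move: klm => /= klm; apply: in_spanD; last apply: in_spanD.
- by apply: (gen (k.+1, l, m)); rewrite /= !addSn klm.
- by apply: (gen (k, l.+1, m)); rewrite /= addnS addSn klm.
- by apply: (gen (k, l, m.+1)); rewrite /= addnS klm.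
Qed.

End RootSpaces.

Lemma free_coordinates (K : fieldType) (V : lmodType K) n (b : 'I_n -> V) (c : 'I_n -> V -> K^o) :
  (forall j, linear (c j)) -> (forall i j, c j (b i) = (i == j)%:R) ->
  forall k : 'I_n -> K, \sum_i k i *: b i = 0 -> forall i, k i = 0.
Proof.
move=> c_lin cb k kb j; have := congr1 (c j) kb; rewrite (linear_at0 (c_lin j)) => <-.
have cD x y : c j (x + y) = c j x + c j y by rewrite -[x]scale1r c_lin !scale1r.
rewrite (big_morph (c j) cD (linear_at0 (c_lin j))) (bigD1 j) //= big1 ?addr0.
  by rewrite -[_ *: b j]addr0 c_lin (linear_at0 (c_lin j)) addr0 cb eqxx [RHS]mulr1.
move=> i /negbTE ij; rewrite -[_ *: b i]addr0 c_lin (linear_at0 (c_lin j)) addr0 cb ij.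
exact: scaler0.
Qed.

(** * Dimensions of root spaces through the Chevalley involution *)

Section Chevalley.
Variables (K : numFieldType) (A : 'M[K]_2) (r : realization A).
Local Notation g := (bkm r).

Lemma chevalley : exists2 omega : g -> g, lie_hom omega &
  forall i, omega (bkm_e r i) = bkm_f r i.
Proof.
pose gen (x : bkm_gen r) : g :=
  match x with Gh h => - bkm_h h | Ge i => bkm_f r i | Gf i => bkm_e r i end.
have [|omega omega_hom omegaE] := @presented_lie_universal K _ (@bkm_rel K A r) g gen; last first.
  by exists omega => // i; apply: (omegaE (Ge r i)).
have bracketNl (x y : g) : bracket (- x) y = - bracket x y.
  by rewrite bracketC bracketNr opprK bracketC.
move=> s t [k h h'|h h'|h i|h i|i j] /=.
- by rewrite bkm_hP opprD scalerN.
- by rewrite bracketNl bracketNr bkm_hh !oppr0.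
- by rewrite bracketNl bkm_hf scaleNr opprK.
- by rewrite bracketNl bkm_he scaleNr.
- rewrite bracketC bkm_ef eq_sym; case: eqP => [->|_] //=.
  by rewrite (linear_at0 (@bkm_hP _ _ _)) oppr0.
Qed.

Variable o : 'I_2.
Local Notation o' := (other o).
Local Notation al := (sroot r o).
Local Notation al' := (sroot r o').
Local Notation F := (fock o (0 : weight r)).

Lemma ladder_word : exists psi : g -> F -> F,
  [/\ forall y, linear (psi^~ y),
      forall x y z, psi (bracket x y) z = psi x (psi y z) - psi y (psi x z)
    & forall i y, psi (ladder_e r o i) y = prepend i y].
Proof.
have [omega [omega_lin omega_br] omega_e] := chevalley.
exists (fun x y => act (omega x) y); split=> [y k x x'|x y z|i y].
- by rewrite omega_lin actDl actZl.
- by rewrite omega_br act_bracket.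
- rewrite (_ : omega _ = ladder r o i) ?ladder_act //.
  by elim: i => [|i IH] /=; rewrite ?omega_br ?IH omega_e.
Qed.

Lemma prependE i (x : F) j s k : prepend i x (j :: s) k = (j == i)%:R * x s k.
Proof. by []. Qed.

Lemma root_dim1 n : has_dim (root_space (al + n%:R *: al')) 1.
Proof.
apply: (@has_dim_basis _ _ _ _ (fun=> ladder_e r o n)).
- exact: root_space0.
- exact: root_spaceD.
- exact: root_spaceZ.
- by move=> _; apply: ladder_root_space.
- move=> x; rewrite -[al]scale1r => xb.
  apply: (@positive_root_space_ind K A r o 1 n%:R) xb => //.
  + exact: in_span0.
  + exact: in_spanD.
  + exact: in_spanZ.
  + move=> w w1 /eqP; rewrite eqr_nat => /eqP <-; have [k ->] := left_normed1 r w1.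
    by apply: in_spanZ; apply: (in_span_gen _ ord0).
- have [psi [psi_lin _ psiE]] := ladder_word.
  apply: (@free_coordinates _ _ _ _ (fun _ x => psi x (delta o 0 ([::], 0%N)) [:: n] 0%N)).
    by move=> _ k x y; rewrite psi_lin.
  by move=> i j; rewrite psiE prependE eqxx mul1r !ord1.
Qed.

Lemma root_dim1_frac v : (forall m, v <> m%:R) -> has_dim (root_space (al + v *: al')) 0.
Proof.
move=> vN; apply: (@has_dim_basis _ _ _ _ (fun=> 0)) => //.
- exact: root_space0.
- exact: root_spaceD.
- exact: root_spaceZ.
- by move=> _; apply: root_space0.
- move=> x; rewrite -[al]scale1r => xb.
  apply: (@positive_root_space_ind K A r o 1 v) xb => //.
  + exact: in_span0.
  + exact: in_spanD.
  + exact: in_spanZ.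
  + by move=> w _ /esym/vN.
- by move=> k _ [].
Qed.

Lemma root_dim2 n : has_dim (root_space (2%:R *: al + n%:R *: al')) (n.+1)./2.
Proof.
(* The bound on [i] says [i < n - i]: one bracket for each unordered pair of distinct indices. *)
pose b (i : 'I_(n.+1)./2) := bracket (ladder_e r o i) (ladder_e r o (n - i)).
apply: (@has_dim_basis _ _ _ _ b).
- exact: root_space0.
- exact: root_spaceD.
- exact: root_spaceZ.
- move=> i; rewrite (_ : _ + _ = (al + i%:R *: al') + (al + (n - i)%:R *: al')).
    by apply: root_space_bracket; apply: ladder_root_space.
  rewrite addrACA -scalerDl -natrD subnKC; last by have := ltn_ord i; lia.
  by rewrite scaler_nat mulr2n.
- move=> x xb; apply: (@positive_root_space_ind K A r o 2 n%:R) xb => //.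
  + exact: in_span0.
  + exact: in_spanD.
  + exact: in_spanZ.
  + move=> w w2 /eqP; rewrite eqr_nat => /eqP wn; have := left_normed2 r w2; rewrite wn.
    elim/in_span_ind=> [|y z|k y|[k l]]; [exact: in_span0|exact: in_spanD|exact: in_spanZ|].
    rewrite /ladder2; case: eqP => [kl|_]; last exact: in_span0.
    have half_span i j : (i + j)%N = n -> (i < (n.+1)./2)%N ->
        in_span b (bracket (ladder_e r o i) (ladder_e r o j)).
      by move=> ij ip; have := in_span_gen b (Ordinal ip); rewrite /b /= -ij addKn.
    move: kl => /= kl; have [kp|pk] := ltnP k (n.+1)./2; first exact: half_span.
    have [lp|pl] := ltnP l (n.+1)./2.
      by rewrite bracketC -scaleN1r; apply/in_spanZ/half_span; rewrite // addnC.
    by rewrite (_ : k = l) ?bracketxx; [exact: in_span0|lia].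
- have [psi [psi_lin psi_br psiE]] := ladder_word.
  apply: (@free_coordinates _ _ _ _ (fun m x => psi x (delta o 0 ([::], 0%N)) [:: (m : nat);
    (n - m)%N] 0%N)).
    by move=> m k x y; rewrite psi_lin.
  move=> i j; rewrite psi_br !psiE vecB !prependE /delta eqxx mulr1.
  have ip := ltn_ord i; have jp := ltn_ord j.
  (* The second term of a commutator has its larger letter first, hence is invisible to the chosen
     coefficients. *)
  rewrite (_ : ((j : nat) == n - i)%N = false) ?mul0r ?subr0; last by apply/eqP => E; lia.
  rewrite -natrM mulnb eq_sym -val_eqE /=; case: eqP => [->|_] //.
  by rewrite eqxx.
Qed.

Lemma root_dim33 : has_dim (root_space (3%:R *: al + 3%:R *: al')) 3.
Proof.
pose tri i j k := bracket (ladder_e r o i) (bracket (ladder_e r o j) (ladder_e r o k)).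
(* The letter contents of sum 3 are 003, 012 and 111; they contribute one, two and no basis
   elements. *)
pose b (i : 'I_3) := nth 0 [:: tri 0 0 3; tri 0 1 2; tri 1 0 2]%N i.
have tri_root i j k : (i + j + k)%N = 3%N -> root_space (3%:R *: al + 3%:R *: al') (tri i j k).
  move=> ijk; rewrite (_ : _ + _ = (al + i%:R *: al') + ((al + j%:R *: al') + (al + k%:R *: al'))).
    by do 2?apply: root_space_bracket; apply: ladder_root_space.
  rewrite [X in _ = _ + X]addrACA [RHS]addrACA -!scalerDl -!natrD addnA ijk.
  by rewrite [3 *: al]scaler_nat !mulrS addr0.
apply: (@has_dim_basis _ _ _ _ b).
- exact: root_space0.
- exact: root_spaceD.
- exact: root_spaceZ.
- by case=> -[|[|[|//]]] i; apply: tri_root.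
- move=> x xb; apply: (@positive_root_space_ind K A r o 3 3%:R) xb => //.
  + exact: in_span0.
  + exact: in_spanD.
  + exact: in_spanZ.
  + move=> w w3 /eqP; rewrite eqr_nat => /eqP wn; have := left_normed3 r w3; rewrite wn.
    elim/in_span_ind=> [|y z|k y|[[i j] k]]; [exact: in_span0|exact: in_spanD|exact: in_spanZ|].
    rewrite /ladder3 /= -/(tri i j k); case: eqP => [ijk|_]; last exact: in_span0.
    have b0 : in_span b (tri 0 0 3)%N := in_span_gen b (@Ordinal 3 0 isT).
    have b1 : in_span b (tri 0 1 2)%N := in_span_gen b (@Ordinal 3 1 isT).
    have b2 : in_span b (tri 1 0 2)%N := in_span_gen b (@Ordinal 3 2 isT).
    have triN i' j' k' : in_span b (tri i' j' k') -> in_span b (tri i' k' j').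
      by rewrite /tri (bracketC (ladder_e r o k')) bracketNr -scaleN1r; apply: in_spanZ.
    have tri0 i' j' : in_span b (tri i' j' j').
      by rewrite /tri bracketxx bracket0r; apply: in_span0.
    (* Antisymmetry and [tri0] leave only this bracket, which the Jacobi identity expresses through
       the other two with letters 0, 1, 2. *)
    have b3 : in_span b (tri 2 0 1)%N.
      have -> : tri 2 0 1 = tri 1 0 2 - tri 0 1 2.
        rewrite {1}/tri bracketA (bracketC (ladder_e r o 2)) (bracketC (ladder_e r o 2) (ladder_e
          r o 1)).
        by rewrite bracketC !bracketNr opprK.
      exact: in_spanB.
    move: i j k ijk => [|[|[|[|i]]]] [|[|[|[|j]]]] [|[|[|[|k]]]] // _; auto.
- have [psi [psi_lin psi_br psiE]] := ladder_word.
  pose c (w : seq nat) (x : g) : K^o := psi x (delta o 0 ([::], 0%N)) w 0%N.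
  (* The coefficient of the word [l m n] in the expanded double commutator. *)
  have cE i j k l m n : c [:: l; m; n] (tri i j k) =
      (l == i)%:R * ((m == j)%:R * (n == k)%:R - (m == k)%:R * (n == j)%:R)
      - ((l == j)%:R * (m == k)%:R - (l == k)%:R * (m == j)%:R) * (n == i)%:R :> K.
    by rewrite /c /tri !psi_br !psiE !vecB !prependE !vecB !prependE /delta eqxx !mulr1; ring.
  apply: (@free_coordinates _ _ _ _
    (fun m => c (nth [::] [:: [:: 0; 0; 3]; [:: 0; 1; 2]; [:: 1; 0; 2]]%N m))).
    by move=> m k x y; rewrite /c psi_lin.
  by move=> [[|[|[|//]]] ?] [[|[|[|//]]] ?]; rewrite /b /= cE /=; ring.
Qed.

End Chevalley.

(** * Assembly of both parts *)

Section Main.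
Variables (K : numFieldType) (A : 'M[K]_2) (r : realization A) (o : 'I_2).
Hypothesis A_neg : forall i j, A i j < 0.
Local Notation o' := (other o).

Lemma maximal2_dim (lam mu : weight r) n :
  mu = lam - 2%:R *: sroot r o - n%:R *: sroot r o' ->
  2 * (A o' o / A o o' * (lam (coroot r o) : K)) + - (A o' o / A o o' * A o o)
    = - (2 * - A o' o * n%:R + quad (lam (coroot r o') : K) (- A o' o') n%:R) ->
  has_dim (maximal_space (verma lam) mu) (uphalf n.+1).
Proof.
move=> mu_def Q; have [phi phi_hom phiv] := fock_hom o lam.
exact: (maximal_dim mu_def phi_hom phiv (highest2_dim A_neg mu_def Q)).
Qed.

Lemma root_dims2 n : exists p q : nat,
  [/\ has_dim (root_space (2%:R *: sroot r o + n%:R *: sroot r o')) p,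
      has_dim (root_space (sroot r o + (n%:R / 2%:R) *: sroot r o')) q
    & uphalf n.+1 = (p + q)%N].
Proof.
(* The root space at [n / 2] is one-dimensional for even [n] and zero for odd [n], where the
   coefficient is not an integer. *)
exists (n.+1)./2, (~~ odd n : nat); split; first exact: root_dim2; last first.
  rewrite -[uphalf n.+1]/(n./2.+1) -[(n.+1)./2]/(uphalf n) uphalf_half.
  by case: (odd n); rewrite ?addn0 ?add0n ?addn1 ?add1n.
have [n_odd|n_even] := boolP (odd n); last first.
  rewrite (_ : n%:R / 2%:R = (n./2)%:R); first exact: root_dim1.
  rewrite -[n in LHS]odd_double_half (negbTE n_even) add0n -muln2 natrM mulfK //.
  by rewrite pnatr_eq0.
apply: root_dim1_frac => m nm.
have /eqP : n%:R = (m * 2)%:R :> K by rewrite natrM -nm divfK // pnatr_eq0.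
by rewrite eqr_nat => /eqP nE; move: n_odd; rewrite nE muln2 odd_double.
Qed.

End Main.

Lemma other1 : other ix1 = ix2. Proof. by rewrite /other eqxx. Qed.
Lemma other2 : other ix2 = ix1. Proof. by []. Qed.

Theorem theorem1p1 (R : realType) (a b c d : nat)
    (a_gt0 : (0 < a)%N) (b_gt0 : (0 < b)%N) (c_gt0 : (0 < c)%N) (d_gt0 : (0 < d)%N)
    (r : realization (bkm_matrix R[i] b a c d))
    (lambda : weight r) (lambdaP : signed_dominant_integral lambda)
    (M1 M2 : nat) (M1_gt0 : (0 < M1)%N) (M2_gt0 : (0 < M2)%N)
    (lambda1 : lambda (coroot r ix1)
               = bkm_matrix R[i] b a c d ix1 ix1 / 2%:R * (M1%:R - 1))
    (lambda2 : lambda (coroot r ix2)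
               = bkm_matrix R[i] b a c d ix2 ix2 / 2%:R * (M2%:R - 1))
    (X Y : nat)
    (XY_eq : b%:R * X%:R ^+ 2 + (a%:R * d%:R / c%:R) * Y%:R ^+ 2
             - b%:R * M1%:R * X%:R - (a%:R * d%:R / c%:R) * M2%:R * Y%:R
             + 2%:R * a%:R * X%:R * Y%:R = 0 :> R[i])
    (mu : weight r)
    (mu_def : mu = lambda - X%:R *: sroot r ix1 - Y%:R *: sroot r ix2) :
  (forall n : nat, (0 < n)%N ->
     ((X = 2%N /\ Y = n) \/ (X = n /\ Y = 2%N) ->
        has_dim (maximal_space (verma lambda) mu) (uphalf n.+1)
        /\ has_dim (module_homs (verma mu) (verma lambda)) (uphalf n.+1))
     /\ (X = 2%N /\ Y = n ->
        exists p q : nat,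
          [/\ has_dim (root_space (2%:R *: sroot r ix1 + n%:R *: sroot r ix2)) p,
              has_dim (root_space (sroot r ix1 + (n%:R / 2%:R) *: sroot r ix2)) q
            & uphalf n.+1 = (p + q)%N])
     /\ (X = n /\ Y = 2%N ->
        exists p q : nat,
          [/\ has_dim (root_space (n%:R *: sroot r ix1 + 2%:R *: sroot r ix2)) p,
              has_dim (root_space ((n%:R / 2%:R) *: sroot r ix1 + sroot r ix2)) q
            & uphalf n.+1 = (p + q)%N]))
  /\ (X = 3%N /\ Y = 3%N ->
        has_dim (maximal_space (verma lambda) mu) 4
        /\ exists p q : nat,
          [/\ has_dim (root_space (sroot r ix1 + sroot r ix2)) p,
              has_dim (root_space (3%:R *: sroot r ix1 + 3%:R *: sroot r ix2)) q
            & (p + q = 4)%N]).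
Proof.
have a0 : a%:R != 0 :> R[i] by rewrite pnatr_eq0 -lt0n.
have c0 : c%:R != 0 :> R[i] by rewrite pnatr_eq0 -lt0n.
have A_neg i j : bkm_matrix R[i] b a c d i j < 0.
  by rewrite mxE oppr_lt0 ltr0n; case: ifP => _; case: ifP => _.
have A21 : (ix2 == ix1) = false by [].
split=> [n _|[X3 Y3]]; [split; [|split]|split].
- move=> XY; suff max_dim : has_dim (maximal_space (verma lambda) mu) (uphalf n.+1).
    by split=> //; apply: hom_dim.
  case: XY XY_eq mu_def => -[-> ->] eq muE.
    apply: (@maximal2_dim _ _ r ix1 A_neg _ _ n); first by rewrite other1.
    rewrite other1 lambda1 lambda2 /quad /bkm_matrix !mxE !eqxx A21.
    (* The quadratic equation is symmetrized by scaling row 2, but [ratio] scales row 1; hence the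
       factor [c / a]. The [2] comes from the halves in [lambda]. *)
    apply/eqP; rewrite -subr_eq0; apply/eqP; rewrite -[RHS](mulr0 (c%:R / a%:R / 2%:R)) -eq.
    by field; rewrite a0 c0.
  (* With the letters exchanged, [ratio] is [a / c], the normalization of the quadratic equation
     itself; only the factor [1 / 2] remains. *)
  apply: (@maximal2_dim _ _ r ix2 A_neg _ _ n); first by rewrite other2 addrAC.
  rewrite other2 lambda1 lambda2 /quad /bkm_matrix !mxE !eqxx A21.
  apply/eqP; rewrite -subr_eq0; apply/eqP; rewrite -[RHS](mulr0 (2%:R^-1)) -eq.
  by field; rewrite c0.
- by move=> _; have := root_dims2 r ix1 n; rewrite other1.
- move=> _; have := root_dims2 r ix2 n; rewrite other2.
  by rewrite addrC [sroot r ix2 + _]addrC.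
- have [phi phi_hom phiv] := fock_hom ix1 lambda.
  rewrite X3 Y3 in XY_eq mu_def.
  apply: (maximal_dim (o := ix1) _ phi_hom phiv (highest3_dim (mu := mu) A_neg _ _));
    rewrite ?other1 //.
  rewrite lambda1 lambda2 /bkm_matrix !mxE !eqxx A21.
  (* The [6] is the same [2] times [3], since the relation for [p1] in degree (3, 3) has been
     divided by 3. *)
  apply/eqP; rewrite -subr_eq0; apply/eqP; rewrite -[RHS](mulr0 (c%:R / a%:R / 6%:R)) -XY_eq.
  by field; rewrite a0 c0.
- exists 1%N, 3%N; split=> //.
    by have := root_dim1 r ix1 1; rewrite other1 scale1r.
  by have := root_dim33 r ix1; rewrite other1.
Qed.
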